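(* A pair of holomorphic functions $f:C_1\to\mathbb{CP}^1$, $g:C_2\to\mathbb{CP}^1$ is irreducible if and only if for any $a\in f^{-1}\{z_0\}$, $b\in g^{-1}\{z_0\}$ the equality $$\Gamma_{f,a}\Gamma_{g,b}=\Gamma_{g,b}\Gamma_{f,a}=\pi_1(\mathbb{CP}^1\setminus S,z_0)$$ holds.
   Context: All Riemann surfaces are connected and compact, and holomorphic functions are nonconstant. $S\subset\mathbb{CP}^1$ is a finite set outside of which both $f$ and $g$ are unramified, and $z_0\in\mathbb{CP}^1\setminus S$. For $f:C_1\to\mathbb{CP}^1$ unramified outside $S$ and $a\in f^{-1}\{z_0\}$, $\Gamma_{f,a}$ is the image of the injective homomorphism $f_\star:\pi_1(C_1\setminus f^{-1}\{S\},a)\to\pi_1(\mathbb{CP}^1\setminus S,z_0)$, a subgroup of finite index; similarly for $g$. The number $o(f,g)$ is the number of orbits of the diagonal monodromy action of $\pi_1(\mathbb{CP}^1\setminus S,z_0)$ on $f^{-1}\{z_0\}\times g^{-1}\{z_0\}$. The pair $f,g$ is called irreducible if $o(f,g)=1$, and reducible otherwise. *)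

(* Defs.v *)
From HB Require Import structures.
From mathcomp Require Import all_boot all_order all_algebra.
From mathcomp Require Import generic_quotient.
From mathcomp Require Import finmap.
From mathcomp Require Import all_classical all_reals all_analysis.
From mathcomp Require Import homotopy complex.
From mathcomp Require Import ring lra.

Set Implicit Arguments.
Unset Strict Implicit.
Unset Printing Implicit Defensive.

Import Order.TTheory GRing.Theory Num.Theory.
Import numFieldNormedType.Exports.

Local Open Scope classical_set_scope.
Local Open Scope ring_scope.
Local Open Scope quotient_scope.

Section unit_interval.
Variable R : realType.

Definition unit_interval : Type := set_type (`[0, 1]%classic : set R).

HB.instance Definition _ := Topological.on unit_interval.

Definition clamp (t : R) : R := Num.max 0 (Num.min t 1).

Lemma clamp_subproof t : clamp t \in (`[0, 1]%classic : set R).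
Proof.
rewrite inE /= in_itv /= /clamp le_max lexx /=.
by rewrite ge_max ler01 ge_min lexx orbT.
Qed.

Definition toI (t : R) : unit_interval := exist _ (clamp t) (clamp_subproof t).

Definition ofI (t : unit_interval) : R := val t.

Lemma ofI_itv t : 0 <= ofI t <= 1.
Proof. by have /set_mem := valP t; rewrite /= in_itv. Qed.

Lemma ofIK : cancel ofI toI.
Proof.
move=> t; apply: val_inj => /=; rewrite /clamp -/(ofI t).
have /andP[t0 t1] := ofI_itv t.
by rewrite (min_idPl t1) (max_idPr t0).
Qed.

Lemma ofI_continuous : continuous ofI.
Proof. exact: initial_continuous. Qed.

Lemma clamp_continuous : continuous clamp.
Proof.
move=> t; apply: (@continuous_max R R (cst 0) (Num.min^~ 1) t).
  exact: cst_continuous.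
apply: (@continuous_min R R id (cst 1) t); first exact: cvg_id.
exact: cst_continuous.
Qed.

Lemma toI_continuous : continuous toI.
Proof.
exact/continuous_comp_initial/clamp_continuous.
Qed.

Lemma clamp_itv t : 0 <= t <= 1 -> clamp t = t.
Proof. by move=> /andP[t0 t1]; rewrite /clamp (min_idPl t1) (max_idPr t0). Qed.

Lemma clamp_le0 t : t <= 0 -> clamp t = 0.
Proof. by move=> t0; rewrite /clamp; apply: max_idPl; rewrite ge_min t0. Qed.

Lemma clamp_ge1 t : 1 <= t -> clamp t = 1.
Proof.
by move=> t1; rewrite /clamp (min_idPr t1); apply: max_idPr; exact: ler01.
Qed.

Lemma zero_one_subproof : toI 0 != toI 1.
Proof.
apply/eqP => /(congr1 ofI) /=; rewrite /ofI /= /clamp minxx.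
rewrite (min_idPl ler01) (max_idPr ler01) maxxx => /esym/eqP.
by rewrite oner_eq0.
Qed.

HB.instance Definition _ :=
  isBiPointed.Build unit_interval zero_one_subproof.

Lemma toI0 t : t <= 0 -> toI t = zero.
Proof. by move=> t0; apply: val_inj; rewrite /= !clamp_le0. Qed.

Lemma toI1 t : 1 <= t -> toI t = one.
Proof. by move=> t0; apply: val_inj; rewrite /= !clamp_ge1. Qed.

Lemma ofI0 : ofI zero = 0.
Proof. by rewrite /ofI /= clamp_le0. Qed.

Lemma ofI1 : ofI one = 1.
Proof. by rewrite /ofI /= clamp_ge1. Qed.

End unit_interval.

Lemma cont_comp (X Y Z : topologicalType) (g : Y -> Z) (f : X -> Y) :
  continuous g -> continuous f -> continuous (fun x => g (f x)).
Proof. by move=> cg cf x; apply: continuous_comp; [exact: cf|exact: cg]. Qed.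

Lemma cont_pair (X Y Z : topologicalType) (f : X -> Y) (g : X -> Z) :
  continuous f -> continuous g -> continuous (fun x => (f x, g x)).
Proof.
move=> cf cg x; apply: cvg_pair.
- exact: cf.
- exact: cg.
Qed.

Lemma cont_fst (X Y Z : topologicalType) (f : X -> Z) :
  continuous f -> continuous (fun p : X * Y => f p.1).
Proof. by move=> cf; apply: cont_comp => // p; exact: cvg_fst. Qed.

Lemma cont_snd (X Y Z : topologicalType) (f : Y -> Z) :
  continuous f -> continuous (fun p : X * Y => f p.2).
Proof. by move=> cf; apply: cont_comp => // p; exact: cvg_snd. Qed.

Lemma cont_proj1 (X Y : topologicalType) : continuous (fun p : X * Y => p.1).
Proof. by move=> p; exact: cvg_fst. Qed.

Lemma cont_proj2 (X Y : topologicalType) : continuous (fun p : X * Y => p.2).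
Proof. by move=> p; exact: cvg_snd. Qed.

Lemma cont_affine (R : realType) (X : topologicalType) (f : X -> R) (a b : R) :
  continuous f -> continuous (fun x => a * f x + b).
Proof.
move=> cf x; apply: cvgD; last exact: cvg_cst.
by apply: cvgM; [exact: cvg_cst|exact: cf].
Qed.

Lemma cont_toI (R : realType) (X : topologicalType) (f : X -> R) :
  continuous f -> continuous (fun x => toI (f x)).
Proof. by move=> cf; apply: cont_comp cf; exact: toI_continuous. Qed.

Lemma if_continuous (R : realType) (T X : topologicalType) (g : T -> R) (c : R)
    (f1 f2 : T -> X) :
  continuous g -> continuous f1 -> continuous f2 ->
  (forall t, g t = c -> f1 t = f2 t) ->
  continuous (fun t => if g t <= c then f1 t else f2 t).
Proof.
move=> cg cf1 cf2 f12 t U /=; have [gtc|gtc|gtc] := ltgtP (g t) c => Ut.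
- have Vt : nbhs t [set u | g u < c].
    by apply: (cg t [set r | r < c]); exact: lt_nbhsl.
  have U1 : nbhs t (f1 @^-1` U) by exact: cf1.
  apply: filterS (filterI U1 Vt) => u /= [Uu /ltW gu].
  by rewrite gu.
- have Vt : nbhs t [set u | c < g u].
    by apply: (cg t [set r | c < r]); exact: lt_nbhsr.
  have U2 : nbhs t (f2 @^-1` U) by exact: cf2.
  apply: filterS (filterI U2 Vt) => u /= [Uu cu].
  by rewrite leNgt cu.
- have U1 : nbhs t (f1 @^-1` U) by exact: cf1.
  have U2 : nbhs t (f2 @^-1` U) by apply: cf2; rewrite -f12.
  by apply: filterS (filterI U1 U2) => u /= [Uu1 Uu2]; case: ifP.
Qed.

Section path_homotopy.
Context {R : realType} {X : topologicalType}.
Local Notation I := (unit_interval R).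
Implicit Types x y z : X.

Definition path_homotopic x y (p q : {path I from x to y}) : Prop :=
  exists H : I * I -> X, [/\ continuous H,
    forall t, H (t, zero) = p t, forall t, H (t, one) = q t,
    forall s, H (zero, s) = x & forall s, H (one, s) = y].

Lemma path_homotopic_refl x y (p : {path I from x to y}) : path_homotopic p p.
Proof.
exists (fun ts => p ts.1); split=> [|//|//|s|s];
  rewrite /= ?path_zero ?path_one //.
by apply: cont_fst; exact: cts_fun.
Qed.

Let half_lt1 : ((1 : R) <= 2^-1) = false.
Proof. by apply/negbTE; rewrite -ltNge; lra. Qed.

Let cI := @ofI_continuous R.

Lemma path_homotopic_sym x y (p q : {path I from x to y}) :
  path_homotopic p q -> path_homotopic q p.
Proof.
move=> [H [cH H0 H1 Hx Hy]].
exists (fun ts => H (ts.1, toI (-1 * ofI ts.2 + 1))); split=> [|t|t|s|s] //=.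
- apply: (cont_comp cH); apply: cont_pair; first exact: cont_proj1.
  by apply/cont_toI/cont_affine/cont_snd.
- by rewrite ofI0 toI1 //; lra.
- by rewrite ofI1 toI0 //; lra.
Qed.

Lemma path_homotopic_trans x y (q p r : {path I from x to y}) :
  path_homotopic p q -> path_homotopic q r -> path_homotopic p r.
Proof.
move=> [H [cH H0 H1 Hx Hy]] [K [cK K0 K1 Kx Ky]].
exists (fun ts => if ofI ts.2 <= 2^-1 then H (ts.1, toI (2 * ofI ts.2 + 0))
                  else K (ts.1, toI (2 * ofI ts.2 - 1))).
split=> [|t|t|s|s] /=.
- apply: if_continuous; first exact: cont_snd.
  + apply: (cont_comp cH); apply: cont_pair; first exact: cont_proj1.
    by apply/cont_toI/cont_affine/cont_snd.
  + apply: (cont_comp cK); apply: cont_pair; first exact: cont_proj1.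
    by apply/cont_toI/cont_affine/cont_snd.
  + by move=> ts ->; rewrite toI1 ?toI0 ?H1 ?K0 //; lra.
- by rewrite ofI0 ifT ?toI0 //; lra.
- by rewrite ofI1 half_lt1 toI1 //; lra.
- by rewrite Hx Kx if_same.
- by rewrite Hy Ky if_same.
Qed.

Lemma path_homotopic_reparam x y (p q : {path I from x to y}) (x' y' : X)
    (r : {path I from x' to y'}) (phi psi : R -> R) :
  continuous phi -> continuous psi ->
  phi 0 = psi 0 -> phi 1 = psi 1 ->
  (forall t, p t = r (toI (phi (ofI t)))) ->
  (forall t, q t = r (toI (psi (ofI t)))) ->
  path_homotopic p q.
Proof.
move=> cphi cpsi e0 e1 pE qE.
pose L (ts : I * I) :=
  (1 - ofI ts.2) * phi (ofI ts.1) + ofI ts.2 * psi (ofI ts.1).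
exists (fun ts => r (toI (L ts))); split.
- apply: (cont_comp (@cts_fun _ _ r)); apply: cont_toI => ts.
  have c1 := @cont_fst _ I _ _ cI.
  have c2 := @cont_snd I _ _ _ cI.
  apply: cvgD; apply: cvgM.
  + by apply: cvgB; [exact: cvg_cst|exact: c2].
  + exact: (cont_comp cphi c1).
  + exact: c2.
  + exact: (cont_comp cpsi c1).
- by move=> t; rewrite pE /L /= ofI0 subr0 mul1r mul0r addr0.
- by move=> t; rewrite qE /L /= ofI1 subrr mul1r mul0r add0r.
- move=> s; rewrite /L /= ofI0 -e0 -mulrDl subrK mul1r.
  by rewrite -ofI0 -pE path_zero.
- move=> s; rewrite /L /= ofI1 -e1 -mulrDl subrK mul1r.
  by rewrite -ofI1 -pE path_one.
Qed.

Section concat.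
Context {x y z : X}.
Variables (p : {path I from x to y}) (q : {path I from y to z}).

Definition concat_fun (t : I) : X :=
  if ofI t <= 2^-1 then p (toI (2 * ofI t)) else q (toI (2 * ofI t - 1)).

Lemma concat_continuous : continuous concat_fun.
Proof.
apply: if_continuous => [//|||t ->].
- apply: (cont_comp (@cts_fun _ _ p)); apply: cont_toI.
  under eq_fun do rewrite -[_ * _]addr0.
  exact: cont_affine.
- by apply: (cont_comp (@cts_fun _ _ q)); exact/cont_toI/cont_affine.
- by rewrite divff // subrr toI1 // toI0 // path_one path_zero.
Qed.

Lemma concat_zero : concat_fun zero = x.
Proof. by rewrite /concat_fun ofI0 invr_ge0 ler0n mulr0 toI0 ?path_zero. Qed.

Lemma concat_one : concat_fun one = z.
Proof.
by rewrite /concat_fun ofI1 half_lt1 toI1 ?path_one //; lra.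
Qed.

Definition concat : {path I from x to z} :=
  mk_path concat_continuous concat_zero concat_one.

Lemma concatE t : concat t =
  if ofI t <= 2^-1 then p (toI (2 * ofI t)) else q (toI (2 * ofI t - 1)).
Proof. by []. Qed.

End concat.

Section path_rev.
Context {x y : X}.
Variable p : {path I from x to y}.

Definition path_rev_fun (t : I) : X := p (toI (1 - ofI t)).

Lemma path_rev_continuous : continuous path_rev_fun.
Proof.
apply: (cont_comp (@cts_fun _ _ p)); apply: cont_toI.
under eq_fun do rewrite addrC -mulN1r.
exact: cont_affine.
Qed.

Lemma path_rev_zero : path_rev_fun zero = y.
Proof. by rewrite /path_rev_fun ofI0 subr0 toI1 ?path_one. Qed.

Lemma path_rev_one : path_rev_fun one = x.
Proof. by rewrite /path_rev_fun ofI1 subrr toI0 ?path_zero. Qed.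

Definition path_rev : {path I from y to x} :=
  mk_path path_rev_continuous path_rev_zero path_rev_one.

Lemma path_revE t : path_rev t = p (toI (1 - ofI t)).
Proof. by []. Qed.

End path_rev.

Definition const_path x : {path I from x to x} := cst x.

Lemma concat_homotopic x y z (p p' : {path I from x to y})
    (q q' : {path I from y to z}) :
  path_homotopic p p' -> path_homotopic q q' ->
  path_homotopic (concat p q) (concat p' q').
Proof.
move=> [H [cH H0 H1 Hx Hy]] [K [cK K0 K1 Kx Ky]].
exists (fun ts => if ofI ts.1 <= 2^-1 then H (toI (2 * ofI ts.1 + 0), ts.2)
                  else K (toI (2 * ofI ts.1 - 1), ts.2)).
split=> [|t|t|s|s] /=.
- apply: if_continuous; first exact: cont_fst.
  + apply: (cont_comp cH); apply: cont_pair; last exact: cont_proj2.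
    by apply/cont_toI/cont_affine/cont_fst.
  + apply: (cont_comp cK); apply: cont_pair; last exact: cont_proj2.
    by apply/cont_toI/cont_affine/cont_fst.
  + by move=> ts ->; rewrite toI1 ?toI0 ?Hy ?Kx //; lra.
- by rewrite H0 K0 concatE addr0.
- by rewrite H1 K1 concatE addr0.
- by rewrite ofI0 ifT ?toI0 //; lra.
- by rewrite ofI1 half_lt1 toI1 //; lra.
Qed.

Lemma path_rev_homotopic x y (p q : {path I from x to y}) :
  path_homotopic p q -> path_homotopic (path_rev p) (path_rev q).
Proof.
move=> [H [cH H0 H1 Hx Hy]].
exists (fun ts => H (toI (-1 * ofI ts.1 + 1), ts.2)); split=> [|t|t|s|s] /=.
- apply: (cont_comp cH); apply: cont_pair; last exact: cont_proj2.
  by apply/cont_toI/cont_affine/cont_fst.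
- by rewrite H0 path_revE mulN1r addrC.
- by rewrite H1 path_revE mulN1r addrC.
- by rewrite ofI0 toI1 //; lra.
- by rewrite ofI1 toI0 //; lra.
Qed.

Lemma toIK (t : R) : 0 <= t -> t <= 1 -> ofI (toI t) = t.
Proof. by move=> t0 t1; rewrite /ofI /= clamp_itv // t0 t1. Qed.

Let cid : continuous (@id R). Proof. by move=> t; exact: cvg_id. Qed.

Let caff (a b : R) : continuous (fun t : R => a * t + b).
Proof. exact: cont_affine. Qed.

Lemma concatA x y z w (p : {path I from x to y}) (q : {path I from y to z})
    (r : {path I from z to w}) :
  path_homotopic (concat (concat p q) r) (concat p (concat q r)).
Proof.
pose psi (t : R) : R :=
  Num.min (2 * t + 0) (Num.min (1 * t + 4^-1) (2^-1 * t + 2^-1)).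
apply: (@path_homotopic_reparam _ _ _ _ _ _ (concat p (concat q r)) psi id).
- move=> t; apply: (@continuous_min R R (fun t => 2 * t + 0)
    (fun t => Num.min (1 * t + 4^-1) (2^-1 * t + 2^-1)) t); first exact: caff.
  apply: (@continuous_min R R (fun t => 1 * t + 4^-1)
    (fun t => 2^-1 * t + 2^-1) t); exact: caff.
- exact: cid.
- rewrite /psi (min_idPl _); first by lra.
  by rewrite le_min; apply/andP; split; lra.
- rewrite /psi (min_idPr _); last by rewrite ge_min; apply/orP; right; lra.
  by rewrite (min_idPr _); lra.
- move=> t; have /andP[t0 t1] := ofI_itv t; rewrite !concatE /psi.
  have [t2|t2] := leP (ofI t) (2^-1); last first.
    rewrite (min_idPr _); last by rewrite ge_min; apply/orP; right; lra.
    rewrite (min_idPr _); last by lra.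
    rewrite (toIK (t := _ + _)); [|lra..].
    rewrite ifF; last by apply/negbTE; rewrite -ltNge; lra.
    rewrite toIK; [|lra..].
    rewrite ifF; last by apply/negbTE; rewrite -ltNge; lra.
    by congr (r (toI _)); field.
  rewrite toIK; [|lra..].
  rewrite (min_idPl (_ : 1 * ofI t + 4^-1 <= _)); last by lra.
  have [t4|t4] := leP (2 * ofI t) (2^-1).
    rewrite (min_idPl _); last by lra.
    rewrite toIK; [|lra..].
    by rewrite ifT ?addr0 //; lra.
  rewrite (min_idPr _); last by lra.
  rewrite toIK; [|lra..].
  have [t5|t5] := leP (1 * ofI t + 4^-1) (2^-1); first by exfalso; lra.
  rewrite toIK; [|lra..].
  rewrite ifT; last by lra.
  by congr (q (toI _)); field.
- by move=> t; rewrite ofIK.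
Qed.

Lemma concat1l x y (p : {path I from x to y}) :
  path_homotopic (concat (const_path x) p) p.
Proof.
apply: (@path_homotopic_reparam _ _ _ _ _ _ p
  (fun t => Num.max 0 (2 * t + -1)) id).
- move=> t; apply: (@continuous_max R R (cst 0) (fun t => 2 * t + -1) t).
    exact: cst_continuous.
  exact: caff.
- exact: cid.
- by rewrite (max_idPl _); lra.
- by rewrite (max_idPr _); lra.
- move=> t; rewrite concatE; case: leP => t2.
    by rewrite (max_idPl _) ?[toI 0]toI0 ?path_zero //; lra.
  by rewrite (max_idPr _) //; lra.
- by move=> t; rewrite ofIK.
Qed.

Lemma concat1r x y (p : {path I from x to y}) :
  path_homotopic (concat p (const_path y)) p.
Proof.
apply: (@path_homotopic_reparam _ _ _ _ _ _ p
  (fun t => Num.min (2 * t + 0) 1) id).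
- move=> t; apply: (@continuous_min R R (fun t => 2 * t + 0) (cst 1) t).
    exact: caff.
  exact: cst_continuous.
- exact: cid.
- by rewrite (min_idPl _); lra.
- by rewrite (min_idPr _); lra.
- move=> t; rewrite concatE; case: leP => t2.
    by rewrite (min_idPl _) ?addr0 //; lra.
  by rewrite (min_idPr _) ?[toI 1]toI1 ?path_one //; lra.
- by move=> t; rewrite ofIK.
Qed.

Lemma concatVr x y (p : {path I from x to y}) :
  path_homotopic (concat p (path_rev p)) (const_path x).
Proof.
apply: (@path_homotopic_reparam _ _ _ _ _ _ p
  (fun t => Num.min (2 * t + 0) ((-2) * t + 2)) (cst 0)).
- move=> t; apply: (@continuous_min R R (fun t => 2 * t + 0)
    (fun t => (-2) * t + 2) t); exact: caff.
- by move=> t; exact: cst_continuous.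
- by rewrite /cst (min_idPl _); lra.
- by rewrite /cst (min_idPr _); lra.
- move=> t; have /andP[t0 t1] := ofI_itv t; rewrite concatE.
  case: leP => t2.
    by rewrite (min_idPl _) ?addr0 //; lra.
  rewrite path_revE toIK; [|lra..].
  rewrite (min_idPr _); last by lra.
  by congr (p (toI _)); ring.
- by move=> t; rewrite /= toI0 ?path_zero.
Qed.

Lemma path_revK x y (p : {path I from x to y}) : path_rev (path_rev p) = p.
Proof.
apply/path_eqP => t; have /andP[t0 t1] := ofI_itv t.
rewrite !path_revE toIK; [|lra..].
by rewrite (_ : 1 - _ = ofI t) ?ofIK //; ring.
Qed.

Lemma concatVl x y (p : {path I from x to y}) :
  path_homotopic (concat (path_rev p) p) (const_path y).
Proof. by rewrite -{2}(path_revK p); exact: concatVr. Qed.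

End path_homotopy.

Section fundamental_group.
Variables (R : realType) (X : topologicalType) (x : X).
Local Notation loop := {path (unit_interval R) from x to x}.

Definition loop_eq (p q : loop) : bool := `[< path_homotopic p q >].

Lemma loop_eq_refl : reflexive loop_eq.
Proof. by move=> p; apply/asboolP; exact: path_homotopic_refl. Qed.

Lemma loop_eq_sym : symmetric loop_eq.
Proof.
by move=> p q; apply/asboolP/asboolP; exact: path_homotopic_sym.
Qed.

Lemma loop_eq_trans : transitive loop_eq.
Proof.
move=> q p r /asboolP pq /asboolP qr; apply/asboolP.
exact: path_homotopic_trans pq qr.
Qed.

Canonical loop_eq_equiv :=
  EquivRel loop_eq loop_eq_refl loop_eq_sym loop_eq_trans.

Definition pi1 : Type := {eq_quot loop_eq}.


HB.instance Definition _ := Choice.on pi1.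
HB.instance Definition _ := EqQuotient.on pi1.

Definition pi1_class (p : loop) : pi1 := \pi_pi1 p.

Lemma pi1_classP p q : pi1_class p = pi1_class q <-> path_homotopic p q.
Proof.
split; first by move/eqmodP/asboolP.
by move=> pq; apply/eqmodP/asboolP.
Qed.

Lemma pi1_ind (P : pi1 -> Prop) : (forall p, P (pi1_class p)) -> forall s, P s.
Proof. by move=> Pp s; rewrite -[s]reprK; exact: Pp. Qed.

Lemma repr_pi1_class p : path_homotopic (repr (pi1_class p)) p.
Proof. by apply/pi1_classP; rewrite /pi1_class reprK. Qed.

(* [pi1_mul s t] runs through [s] first and through [t] next. *)
Definition pi1_mul (s t : pi1) : pi1 := pi1_class (concat (repr s) (repr t)).
Definition pi1_one : pi1 := pi1_class (const_path x).
Definition pi1_inv (s : pi1) : pi1 := pi1_class (path_rev (repr s)).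

Lemma pi1_mulE p q :
  pi1_mul (pi1_class p) (pi1_class q) = pi1_class (concat p q).
Proof.
by apply/pi1_classP/concat_homotopic; exact: repr_pi1_class.
Qed.

Lemma pi1_invE p : pi1_inv (pi1_class p) = pi1_class (path_rev p).
Proof. by apply/pi1_classP/path_rev_homotopic; exact: repr_pi1_class. Qed.

Lemma pi1_mulA : associative pi1_mul.
Proof.
move=> s t u; elim/pi1_ind: s => p; elim/pi1_ind: t => q.
elim/pi1_ind: u => r; rewrite !pi1_mulE.
by apply/pi1_classP/path_homotopic_sym; exact: concatA.
Qed.

Lemma pi1_mul1 : left_id pi1_one pi1_mul.
Proof.
elim/pi1_ind => p; rewrite pi1_mulE.
by apply/pi1_classP; exact: concat1l.
Qed.

Lemma pi1_1mul : right_id pi1_one pi1_mul.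
Proof.
elim/pi1_ind => p; rewrite pi1_mulE.
by apply/pi1_classP; exact: concat1r.
Qed.

Lemma pi1_mulV : left_inverse pi1_one pi1_inv pi1_mul.
Proof.
elim/pi1_ind => p; rewrite pi1_invE pi1_mulE.
by apply/pi1_classP; exact: concatVl.
Qed.

Lemma pi1_Vmul : right_inverse pi1_one pi1_inv pi1_mul.
Proof.
elim/pi1_ind => p; rewrite pi1_invE pi1_mulE.
by apply/pi1_classP; exact: concatVr.
Qed.

HB.instance Definition _ := isGroup.Build pi1
  pi1_mulA pi1_mul1 pi1_1mul pi1_mulV pi1_Vmul.

End fundamental_group.

Lemma pi1_mulgE (R : realType) (X : topologicalType) (x : X)
    (p q : {path (unit_interval R) from x to x}) :
  (pi1_class p * pi1_class q)%g = pi1_class (concat p q).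
Proof. exact: pi1_mulE. Qed.

Section induced_map.
Context {R : realType} {X Y : topologicalType} {x : X} {y : Y}.
Variable f : X -> Y.
Hypotheses (cf : continuous f) (fx : f x = y).
Local Notation I := (unit_interval R).

Section image_path.
Variable p : {path I from x to x}.

Lemma image_loop_continuous : continuous (f \o p).
Proof. by apply: cont_comp => //; exact: cts_fun. Qed.

Lemma image_loop_zero : (f \o p) zero = y.
Proof. by rewrite /= path_zero. Qed.

Lemma image_loop_one : (f \o p) one = y.
Proof. by rewrite /= path_one. Qed.

Definition image_loop : {path I from y to y} :=
  mk_path image_loop_continuous image_loop_zero image_loop_one.

End image_path.

Definition pi1_map (s : pi1 R x) : pi1 R y := pi1_class (image_loop (repr s)).

Lemma pi1_mapE p : pi1_map (pi1_class p) = pi1_class (image_loop p).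
Proof.
apply/pi1_classP; have [H [cH H0 H1 Hx Hy]] := repr_pi1_class p.
exists (f \o H); split => [|t|t|s|s] /=; rewrite ?H0 ?H1 ?Hx ?Hy //.
exact: cont_comp.
Qed.

Lemma pi1_mapM : {morph pi1_map : s t / (s * t)%g >-> (s * t)%g}.
Proof.
move=> s t; elim/pi1_ind: s => p; elim/pi1_ind: t => q.
rewrite pi1_mulgE !pi1_mapE pi1_mulgE; congr pi1_class.
apply/path_eqP => u.
change (f (concat p q u) = concat (image_loop p) (image_loop q) u).
by rewrite !concatE; case: ifP.
Qed.

End induced_map.

(* The norm topology and normed module structure of a numFieldType are only
   found on a term of type [numFieldType], not on [R[i]] itself. In particular
   [derivable f z 1], for [f : Cplx R -> Cplx R], is complex differentiability. *)
Definition Cplx (R : realType) : numFieldType := R[i].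

(* [chart_fun] is relevant on [chart_dom] only, and [chart_inv] on its image. *)
Record chart (R : realType) (X : topologicalType) := Chart {
  chart_dom : set X;
  chart_fun :> X -> Cplx R;
  chart_inv : Cplx R -> X;
  chart_dom_open : open chart_dom;
  chart_img_open : open (chart_fun @` chart_dom);
  chart_funK : {in chart_dom, cancel chart_fun chart_inv};
  chart_continuous : {in chart_dom, continuous chart_fun};
  chart_inv_continuous : {in chart_fun @` chart_dom, continuous chart_inv}
}.

(* Compact connected Riemann surfaces; second countability follows from
   compactness. *)
Record riemannSurface (R : realType) := RiemannSurface {
  rs_space :> topologicalType;
  rs_hausdorff : hausdorff_space rs_space;
  rs_connected : connected [set: rs_space];
  rs_compact : compact [set: rs_space];
  rs_atlas : set (chart R rs_space);
  rs_cover : forall p, exists2 c, rs_atlas c & chart_dom c p;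
  rs_compat : forall c d, rs_atlas c -> rs_atlas d -> forall p,
    chart_dom c p -> chart_dom d p -> derivable (d \o chart_inv c) (c p) 1
}.

Section complex_topology.
Variable R : realType.
Local Notation C := (Cplx R).

Definition cmod (z : C) : R := complex.Re (`|z| : R[i]).

Lemma cmodE (z : C) : `|z| = real_complex R (cmod z).
Proof. by rewrite /cmod (normc_def (z : R[i])). Qed.

Lemma cmodP (z : C) (r : R) : (`|z| < real_complex R r :> C) = (cmod z < r).
Proof. by rewrite cmodE -(ltcR (cmod z) r). Qed.

Lemma cmod_sub (z w : C) : cmod (z - w) = cmod (w - z).
Proof. by rewrite /cmod distrC. Qed.

Lemma cmodD (z w : C) : cmod (z + w) <= cmod z + cmod w.
Proof. by rewrite -(lecR (cmod _)) rmorphD /= -!cmodE; exact: (@ler_normD _ C). Qed.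

Lemma cmod_ge0 (z : C) : 0 <= cmod z.
Proof. by rewrite -(lecR 0) -cmodE; exact: (@normr_ge0 _ C). Qed.

Lemma cmodV (z : C) : cmod z^-1 = (cmod z)^-1.
Proof.
by apply: (@complexI R); rewrite -cmodE normfV cmodE [RHS]fmorphV.
Qed.

Lemma cmod0 : cmod 0 = 0.
Proof. by apply: (@complexI R); rewrite -cmodE normr0. Qed.

Lemma cmod_gt0 (z : C) : (0 < cmod z) = (z != 0).
Proof. by rewrite -(ltcR 0) -cmodE; exact: (@normr_gt0 _ C). Qed.

Lemma cnbhsP (z : C) (U : set C) :
  nbhs z U <-> exists2 e : R, 0 < e & forall w, cmod (w - z) < e -> U w.
Proof.
split.
  move=> /nbhs_ballP[e /= e0 eU]; move: (e0); rewrite ltcE => /andP[/eqP eI eR].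
  have eE : e = real_complex R (complex.Re e) by case: (e) eI => a b /= ->.
  exists (complex.Re e) => // w zw; apply: eU.
  by rewrite -ball_normE /= distrC eE cmodP.
move=> [e e0 eU]; apply/nbhs_ballP; exists (real_complex R e) => /=.
  by rewrite (ltcR 0).
by move=> w; rewrite -ball_normE /= distrC cmodP; exact: eU.
Qed.

Lemma cmod_continuous : continuous cmod.
Proof.
move=> z U /nbhs_ballP[e /= e0 eU]; apply/cnbhsP; exists e => // w zw.
apply: eU; rewrite -ball_normE /= ltr_norml; have := cmodD (w - z) z; have := cmodD (z - w) w.
by rewrite !subrK cmod_sub => *; apply/andP; split; lra.
Qed.

Definition mkC (p : R * R) : C := (p.1 +i* p.2)%C.

Lemma cmod_le (p : R * R) : cmod (mkC p) <= `|p.1| + `|p.2|.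
Proof.
case: p => a b; rewrite /cmod (normc_def (mkC (a, b))) /=.
rewrite -[leRHS]ger0_norm ?addr_ge0 // -sqrtr_sqr ler_wsqrtr //.
have := normr_ge0 a; have := normr_ge0 b.
by rewrite -(real_normK (num_real a)) -(real_normK (num_real b)); nra.
Qed.

Lemma cmod_ge (p : R * R) : `|p.1| <= cmod (mkC p) /\ `|p.2| <= cmod (mkC p).
Proof.
case: p => a b; rewrite /cmod (normc_def (mkC (a, b))) /=.
by split; rewrite -sqrtr_sqr ler_wsqrtr // ?lerDl ?lerDr sqr_ge0.
Qed.

Lemma mkC_continuous : continuous mkC.
Proof.
move=> p U /cnbhsP[e e0 eU].
apply/nbhs_ballP; exists (e / 2) => /=; first by rewrite divr_gt0.
move=> q [/=]; rewrite -!ball_normE /= => h1 h2; apply: eU.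
rewrite (_ : mkC q - mkC p = mkC (q.1 - p.1, q.2 - p.2)) //.
apply: le_lt_trans (cmod_le _) _ => /=.
by rewrite distrC [X in _ + X]distrC; lra.
Qed.

Lemma mkC_surj (z : C) : exists p, mkC p = z.
Proof. by case: z => a b; exists (a, b). Qed.

Lemma closed_cball (r : R) : closed [set z : C | cmod z <= r].
Proof.
apply: (@preimage_closed _ _ cmod [set x | x <= r]).
  by move=> z _; exact: cmod_continuous.
exact: closed_le.
Qed.

Lemma compact_cball (r : R) : compact [set z : C | cmod z <= r].
Proof.
apply: (@subclosed_compact _ _ (mkC @` (`[-r, r] `*` `[-r, r]))).
- exact: closed_cball.
- apply: continuous_compact; last by apply: compact_setX; exact: segment_compact.
  by apply: continuous_subspaceT; exact: mkC_continuous.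
- move=> z /=; have [p <-] := mkC_surj z => pr; exists p => //.
  have [p1 p2] := cmod_ge p.
  by split; rewrite /= in_itv /= -ler_norml; apply: le_trans pr.
Qed.

Lemma C_locally_compact : locally_compact [set: C].
Proof.
move=> z _; rewrite withinET.
exists [set w : C | cmod w <= cmod z + 1]; last first.
  by split; [exact: compact_cball|exact: closed_cball].
apply/cnbhsP; exists 1 => // w zw /=.
by have := cmodD (w - z) z; rewrite subrK; lra.
Qed.

Lemma C_hausdorff : hausdorff_space C.
Proof. exact: norm_hausdorff. Qed.

Lemma C_compact_bounded (K : set C) : compact K ->
  exists2 M : R, 0 < M & forall z, K z -> cmod z <= M.
Proof.
move=> cK; have : compact (cmod @` K).
  apply: continuous_compact => //.
  by apply: continuous_subspaceT; exact: cmod_continuous.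
move=> /(@compact_bounded R R) [M [_ MP]].
exists (Num.max M 0 + 1); first by rewrite ltr_wpDl // le_max lexx orbT.
move=> z Kz; apply: le_trans (MP _ _ (cmod z) _); last by exists z.
  exact: ler_norm.
by rewrite ltr_pwDr // le_max lexx.
Qed.

Lemma C_connected : connected [set: C].
Proof.
pose line (p : R * R) := [set mkC (t * p.1, t * p.2) | t in [set: R]].
have -> : [set: C] = \bigcup_(p in [set: R * R]) line p.
  apply/seteqP; split => // z _; have [p <-] := mkC_surj z.
  by exists p => //; exists 1 => //; rewrite !mul1r; case: p.
apply: bigcup_connected.
  by exists (mkC (0, 0)) => p _; exists 0 => //; rewrite !mul0r.
move=> p _; apply: connected_continuous_connected.
  by apply/connected_intervalP.
apply: continuous_subspaceT.
apply: (cont_comp mkC_continuous); apply: cont_pair => t.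
  by apply: cvgM; [exact: cvg_id|exact: cvg_cst].
by apply: cvgM; [exact: cvg_id|exact: cvg_cst].
Qed.

End complex_topology.

Section riemann_sphere.
Variable R : realType.
Local Notation C := (Cplx R).

(* CP^1 as C together with a point at infinity: [Some z] is [z : 1] and [None]
   is [1 : 0]; the charts are z and 1/z. *)
Definition sphere : topologicalType := one_point_compactification C.

Lemma sphere_hausdorff : hausdorff_space sphere.
Proof.
exact: one_point_compactification_hausdorff (@C_locally_compact R)
  (@C_hausdorff R).
Qed.

Lemma sphere_compact : compact [set: sphere].
Proof. exact: one_point_compactification_compact. Qed.

Lemma sphere_someP (z : C) (U : set sphere) :
  nbhs (Some z : sphere) U <-> nbhs z (fun w => U (Some w)).
Proof. by []. Qed.

Lemma sphere_noneP (U : set sphere) :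
  nbhs (None : sphere) U <->
  U None /\ exists2 M : R, 0 < M & forall w : C, M < cmod w -> U (Some w).
Proof.
split.
  move=> [K [cK _] KU]; split; first by apply: KU; right.
  have [M M0 KM] := C_compact_bounded cK; exists M => // w Mw.
  apply: KU; left; exists w => //= Kw.
  by have := KM _ Kw; rewrite leNgt Mw.
move=> [U0 [M M0 MU]]; exists [set w : C | cmod w <= M].
  by split; [exact: compact_cball|exact: closed_cball].
by move=> _ [[w /= /negP + <-]|-> //]; rewrite -ltNge; exact: MU.
Qed.

Lemma sphere_connected : connected [set: sphere].
Proof.
have -> : [set: sphere] = closure [set (Some z : sphere) | z in [set: C]].
  apply/seteqP; split => // -[z|] _ U.
    by move/nbhs_singleton => Uz; exists (Some z); split => //; exists z.
  move/sphere_noneP => [_ [M M0 MU]].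
  exists (Some (mkC (M + 1, 0))); split; first by exists (mkC (M + 1, 0)).
  apply: MU; have [+ _] := cmod_ge (M + 1, 0).
  by have := ler_norm (M + 1) => /=; lra.
apply: connected_closure; apply: connected_continuous_connected.
  exact: C_connected.
apply: continuous_subspaceT.
exact: one_point_compactification_some_continuous.
Qed.

Definition affine_dom : set sphere := [set p | p <> None].
Definition affine_fun (p : sphere) : C := if p is Some z then z else 0.
Definition affine_inv (z : C) : sphere := Some z.

Definition infty_dom : set sphere := [set p | p <> Some 0].
Definition infty_fun (p : sphere) : C := if p is Some z then z^-1 else 0.
Definition infty_inv (w : C) : sphere := if w == 0 then None else Some w^-1.

Lemma affine_dom_open : open affine_dom.
Proof.
have -> : affine_dom = [set (Some z : sphere) | z in [set: C]].
  by apply/seteqP; split=> [[z|]|_ [z _ <-]] //= _; exists z.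
by apply: one_point_compactification_open_some; exact: openT.
Qed.

Lemma affine_img_open : open (affine_fun @` affine_dom).
Proof.
rewrite (_ : _ @` _ = setT); first exact: openT.
by apply/seteqP; split => // z _; exists (Some z).
Qed.

Lemma affine_funK : {in affine_dom, cancel affine_fun affine_inv}.
Proof. by case=> [z|] // /set_mem. Qed.

Lemma affine_continuous : {in affine_dom, continuous affine_fun}.
Proof. by case=> [z|] => [_|/set_mem //] U zU; apply/sphere_someP. Qed.

Lemma affine_inv_continuous :
  {in affine_fun @` affine_dom, continuous affine_inv}.
Proof. by move=> z _; exact: one_point_compactification_some_continuous. Qed.

Definition affine_chart : chart R sphere :=
  Chart affine_dom_open affine_img_open affine_funK affine_continuous
    affine_inv_continuous.

Lemma infty_funK : {in infty_dom, cancel infty_fun infty_inv}.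
Proof.
case=> [z|] /set_mem /= hz; rewrite /infty_inv /infty_fun ?eqxx //.
rewrite invr_eq0; case: eqP => [z0|_]; last by rewrite invrK.
by case: hz; rewrite z0.
Qed.

Lemma infty_dom_open : open infty_dom.
Proof.
rewrite openE => -[z|] hz.
  apply/sphere_someP; have z0 : z != 0 by apply/eqP => z0; apply: hz; rewrite z0.
  apply/cnbhsP; exists (cmod z); first by rewrite cmod_gt0.
  by move=> w + [w0]; rewrite w0 cmod_sub subr0 ltxx.
apply/sphere_noneP; split => //; exists 1 => // w w1 [w0].
by move: w1; rewrite w0 cmod0 ltr10.
Qed.

Lemma infty_imgE : infty_fun @` infty_dom = setT.
Proof.
apply/seteqP; split => // w _; exists (infty_inv w).
  rewrite /infty_dom /infty_inv /=; case: eqP => // /eqP w0 [] /eqP.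
  by rewrite invr_eq0 (negbTE w0).
by rewrite /infty_inv; case: eqP => [->|_] //=; rewrite invrK.
Qed.

Lemma infty_img_open : open (infty_fun @` infty_dom).
Proof. by rewrite infty_imgE; exact: openT. Qed.

Lemma infty_continuous : {in infty_dom, continuous infty_fun}.
Proof.
case=> [z|] /set_mem hz U hU.
  apply/sphere_someP; have z0 : z != 0 by apply/eqP => z0; apply: hz; rewrite z0.
  exact: (inv_continuous z0 hU).
have [e e0 eU] := (cnbhsP _ _).1 hU.
apply/sphere_noneP; split; first exact: nbhs_singleton hU.
exists e^-1; first by rewrite invr_gt0.
move=> w ew; apply: eU; rewrite subr0 cmodV.
have w0 : 0 < cmod w by apply: lt_trans ew; rewrite invr_gt0.
by rewrite -[ltRHS]invrK ltf_pV2 ?posrE ?invr_gt0.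
Qed.

Lemma infty_inv_continuous :
  {in infty_fun @` infty_dom, continuous infty_inv}.
Proof.
move=> w _ U; have [->|w0] := eqVneq w 0.
  rewrite {1}/infty_inv eqxx => /sphere_noneP[U0 [M M0 MU]].
  apply/cnbhsP; exists M^-1; first by rewrite invr_gt0.
  move=> z; rewrite subr0 /infty_inv /= => zM.
  case: eqP => [//|/eqP z0].
  apply: MU; rewrite cmodV -[M]invrK ltf_pV2 ?posrE ?invr_gt0 //.
  by rewrite cmod_gt0.
rewrite {1}/infty_inv (negbTE w0) => hU.
have V1 : nbhs w [set v : C | U (Some v^-1)].
  exact: (inv_continuous w0 ((sphere_someP _ _).1 hU)).
have V2 : nbhs w [set v : C | v != 0].
  apply/cnbhsP; exists (cmod w); first by rewrite cmod_gt0.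
  move=> v vw; apply/eqP => v0.
  by move: vw; rewrite v0 cmod_sub subr0 ltxx.
apply: filterS (filterI V1 V2) => v /= [Uv v0].
by rewrite /infty_inv (negbTE v0).
Qed.

Definition infty_chart : chart R sphere :=
  Chart infty_dom_open infty_img_open infty_funK infty_continuous
    infty_inv_continuous.

Definition sphere_atlas : set (chart R sphere) := [set affine_chart; infty_chart].

Lemma sphere_cover (p : sphere) : exists2 c, sphere_atlas c & chart_dom c p.
Proof.
case: p => [z|]; first by exists affine_chart => //; left.
by exists infty_chart => //; right.
Qed.

Lemma derivable_inv (z : C) : z != 0 -> derivable (@GRing.inv C) z 1.
Proof. by move=> z0; apply: derivableV => //; exact: derivable_id. Qed.

Lemma affine_inftyE : affine_fun \o infty_inv = GRing.inv.
Proof.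
apply/funext => w /=; rewrite /infty_inv; case: eqP => [->|_] //=.
by rewrite invr0.
Qed.

Lemma infty_inftyE : infty_fun \o infty_inv = id.
Proof.
apply/funext => w /=; rewrite /infty_inv; case: eqP => [->|_] //=.
by rewrite invrK.
Qed.

Lemma sphere_compat (c d : chart R sphere) :
  sphere_atlas c -> sphere_atlas d -> forall p,
  chart_dom c p -> chart_dom d p -> derivable (d \o chart_inv c) (c p) 1.
Proof.
move=> [->|->] [->|->] p /= h1 h2.
- exact: derivable_id.
- case: p h1 h2 => [z|] // _ h2.
  by apply: derivable_inv; apply/eqP => z0; apply: h2; congr Some.
- rewrite affine_inftyE; case: p h1 h2 => [z|] // h1 _.
  apply: derivable_inv; rewrite invr_eq0; apply/eqP => z0.
  by apply: h1; congr Some.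
- by rewrite infty_inftyE; exact: derivable_id.
Qed.

Definition CP1 : riemannSurface R :=
  RiemannSurface sphere_hausdorff sphere_connected sphere_compact
    sphere_cover sphere_compat.

End riemann_sphere.

(* Holomorphic maps are taken nonconstant. *)
Record holomorphicMap (R : realType) (X Y : riemannSurface R) :=
    HolomorphicMap {
  holo_fun :> X -> Y;
  holo_continuous : continuous holo_fun;
  holo_derivable : forall c d, rs_atlas c -> rs_atlas d -> forall p,
    chart_dom c p -> chart_dom d (holo_fun p) ->
    derivable (d \o holo_fun \o chart_inv c) (c p) 1;
  holo_nonconstant : exists p q, holo_fun p <> holo_fun q
}.

Section monodromy.
Context {R : realType} {X Y : riemannSurface R}.
Local Notation I := (unit_interval R).

Definition unramified_at (f : holomorphicMap X Y) (p : X) : Prop :=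
  forall c d, rs_atlas c -> rs_atlas d ->
    chart_dom c p -> chart_dom d (f p) ->
    derive1 (d \o f \o chart_inv c) (c p) != 0.

Definition unramified_outside (f : holomorphicMap X Y) (S : set Y) : Prop :=
  forall p, ~ S (f p) -> unramified_at f p.

Variables (f : holomorphicMap X Y) (S : set Y).

(* The restriction of [f] to the complements of [f^-1(S)] and of [S]. *)
Definition punctured_map (p : ~` (f @^-1` S)) : ~` S :=
  exist _ (f (val p)) (mem_set (set_mem (valP p))).

Lemma punctured_map_continuous : continuous punctured_map.
Proof.
apply: continuous_comp_initial.
apply: (cont_comp (@holo_continuous _ _ _ f)).
exact: initial_continuous.
Qed.

Variable z0 : ~` S.

Definition fiber : set X := f @^-1` [set val z0].

Lemma fiber_subproof (a : fiber) : val a \in ~` (f @^-1` S).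
Proof.
apply/mem_set => /=; have /set_mem /= -> := valP a.
exact: (set_mem (valP z0)).
Qed.

Definition fiber_pt (a : fiber) : ~` (f @^-1` S) :=
  exist _ (val a) (fiber_subproof a).

Lemma punctured_map_fiber (a : fiber) : punctured_map (fiber_pt a) = z0.
Proof. by apply: val_inj; have /set_mem := valP a. Qed.

Definition Gamma (a : fiber) : set (pi1 R z0) :=
  range (pi1_map punctured_map_continuous (punctured_map_fiber a)).

(* The graph of the action: [s] takes [a] to the endpoint [a'] of a lift
   starting at [a] of a loop of class [s]; with the order of composition chosen
   for [pi1_mul] this is a right action. *)
Definition monodromy (s : pi1 R z0) (a a' : fiber) : Prop :=
  exists (g : {path I from z0 to z0})
         (h : {path I from fiber_pt a to fiber_pt a'}),
    pi1_class g = s /\ forall t, punctured_map (h t) = g t.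

End monodromy.

Section orbits.
Context {R : realType} {X1 X2 Y : riemannSurface R}.
Variables (f : holomorphicMap X1 Y) (g : holomorphicMap X2 Y).
Variables (S : set Y) (z0 : ~` S).

Definition diag_orbit (ab : fiber f z0 * fiber g z0) :
    set (fiber f z0 * fiber g z0) :=
  [set ab' | exists s : pi1 R z0,
    monodromy s ab.1 ab'.1 /\ monodromy s ab.2 ab'.2].

(* [fset_set] sends infinite sets to the empty one, so that infinitely many
   orbits would be counted as 0; this cannot happen, fibers being finite. *)
Definition num_orbits : nat := #|` fset_set (range diag_orbit)|%fset.

Definition irreducible_pair : Prop := num_orbits = 1%N.

End orbits.

Definition set_mulg (G : groupType) (A B : set G) : set G :=
  [set (s * t)%g | s in A & t in B].

(* Main.v *)
Require Import Defs.
From HB Require Import structures.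
From mathcomp Require Import all_boot all_order all_algebra.
From mathcomp Require Import finmap.
From mathcomp Require Import all_classical all_reals all_analysis.
From mathcomp Require Import homotopy complex.
From mathcomp Require Import ring lra.

(** Write G for the fundamental group of CP^1 minus S, acting by monodromy on the
    fibers of f and g over z0. The subgroup Gamma attached to a point of a fiber
    is the stabilizer of that point (GammaE). The pair is irreducible when G is
    transitive on the product of the two fibers. As G is transitive on each
    fiber, this is so if and only if the stabilizer of each a is transitive on
    the fiber of g, that is, if and only if the stabilizers of a and of b
    multiply to G (irreducible_iff_stabilizer_product).

    This uses three facts of geometry. Every loop lifts from every point of a
    fiber (path_lifting): off S, where f is unramified, f has continuous local
    inverses (local_inverse), and compactness makes it a covering
    (evenly_covered). The action on a fiber is transitive: the preimage of S is
    discrete (fiber_isolated), so its complement is path connected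
    (complement_path_connected). Fibers are not empty: any point off the preimage
    of S can be moved to the fiber by lifting a path.

    The maps are only assumed to be complex differentiable, so local inverses and
    the identity theorem have to be derived from differentiability. Both follow
    from the maximum principle for functions that are differentiable off a finite
    set (maximum_principle), applied to difference quotients (strict_derivative)
    and to quotients by a product of many zeros (zero_near_limit_of_zeros). The
    maximum principle itself comes from Goursat's argument and Cauchy's formula,
    both in an approximate form, for Riemann sums along the boundary of a
    square. *)

Set Implicit Arguments.
Unset Strict Implicit.
Unset Printing Implicit Defensive.

Import Order.TTheory GRing.Theory Num.Theory.
Import numFieldNormedType.Exports.

Local Open Scope classical_set_scope.
Local Open Scope ring_scope.

(** * Bisection of squares *)

Section square_induction.
Context {R : realType}.

(** Bisection: a failure of P on a square would be inherited by one of its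
    quarters, hence by a nested sequence of squares shrinking to a point (a, b),
    around which P holds. With a P that ignores y this is an induction on
    intervals. *)
Lemma square_induction (P : R -> R -> R -> Prop) :
  (forall x y k : R, 0 < k -> P x y k -> P (x + k) y k -> P x (y + k) k ->
     P (x + k) (y + k) k -> P x y (k + k)) ->
  forall x0 y0 h0 : R, 0 < h0 ->
  (forall a b : R, x0 <= a <= x0 + h0 -> y0 <= b <= y0 + h0 ->
     exists2 d : R, 0 < d & forall x y h : R, 0 < h < d ->
       x <= a <= x + h -> y <= b <= y + h ->
       x0 <= x -> x + h <= x0 + h0 -> y0 <= y -> y + h <= y0 + h0 ->
       P x y h) ->
  P x0 y0 h0.
Proof.
move=> Pjoin x0 y0 h0 h00 Ploc; apply: contrapT => nP0.
pose bad (u : R * R * R) := 0 < u.2 /\ ~ P u.1.1 u.1.2 u.2.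
pose sub (u v : R * R * R) := [/\ v.2 + v.2 = u.2,
  u.1.1 <= v.1.1, v.1.1 + v.2 <= u.1.1 + u.2,
  u.1.2 <= v.1.2 & v.1.2 + v.2 <= u.1.2 + u.2].
have step u : exists v, bad u -> bad v /\ sub u v.
  case: (pselect (bad u)) => [|nb]; last by exists u.
  case: u => [[x y] h] [/= h1 nP]; pose k := h / 2.
  have hE : h = k + k by rewrite /k; lra.
  have k0 : 0 < k by rewrite /k; lra.
  have [H|H] := pselect (P x y k); last first.
    by exists (x, y, k) => _; split; [split|rewrite /sub/=; split; lra].
  have [H1|H1] := pselect (P (x + k) y k); last first.
    by exists (x + k, y, k) => _; split; [split|rewrite /sub/=; split; lra].
  have [H2|H2] := pselect (P x (y + k) k); last first.
    by exists (x, y + k, k) => _; split; [split|rewrite /sub/=; split; lra].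
  exists (x + k, y + k, k) => _; split; last by rewrite /sub/=; split; lra.
  split=> //= H3.
  by apply: nP; rewrite hE; exact: Pjoin.
have [nx nxP] := choice step.
pose u n := iter n nx (x0, y0, h0).
have ubad n : bad (u n).
  by elim: n => [//|n IH]; rewrite /u iterS; apply: (nxP _ _).1.
have usub n : sub (u n) (u n.+1) by apply: (nxP _ _).2; exact: ubad.
have udist n m : [/\ (u n).1.1 <= (u (m + n)%N).1.1,
    (u (m + n)%N).1.1 + (u (m + n)%N).2 <= (u n).1.1 + (u n).2,
    (u n).1.2 <= (u (m + n)%N).1.2 &
    (u (m + n)%N).1.2 + (u (m + n)%N).2 <= (u n).1.2 + (u n).2].
  elim: m => [|m [a b c d]]; first by rewrite add0n.
  by have [_ a' b' c' d'] := usub (m + n)%N; rewrite addSn; split; lra.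
have upos n : 0 < (u n).2 by case: (ubad n).
have ucross n m : (u n).1.1 <= (u m).1.1 + (u m).2 /\
    (u n).1.2 <= (u m).1.2 + (u m).2.
  have [nm|/ltnW nm] := leqP n m.
    have [a b c d] := udist n (m - n)%N; rewrite subnK // in a b c d.
    by have := upos m; split; lra.
  have [a b c d] := udist m (n - m)%N; rewrite subnK // in a b c d.
  by have := upos n; split; lra.
pose a := sup (range (fun n => (u n).1.1)).
pose b := sup (range (fun n => (u n).1.2)).
have aP n : (u n).1.1 <= a <= (u n).1.1 + (u n).2.
  apply/andP; split.
    apply: ub_le_sup; last by exists n.
    by exists ((u 0%N).1.1 + (u 0%N).2) => _ [m _ <-]; case: (ucross m 0%N).
  apply: ge_sup; first by exists (u 0%N).1.1; exists 0%N.
  by move=> _ [m _ <-]; case: (ucross m n).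
have bP n : (u n).1.2 <= b <= (u n).1.2 + (u n).2.
  apply/andP; split.
    apply: ub_le_sup; last by exists n.
    by exists ((u 0%N).1.2 + (u 0%N).2) => _ [m _ <-]; case: (ucross m 0%N).
  apply: ge_sup; first by exists (u 0%N).1.2; exists 0%N.
  by move=> _ [m _ <-]; case: (ucross m n).
have [d d0 dP] := Ploc a b (aP 0%N) (bP 0%N).
have usize n : (u n).2 * n.+1%:R <= h0.
  elim: n => [|n IH]; first by rewrite mulr1.
  have [e _ _ _ _] := usub n; rewrite -e in IH.
  have n1 : (n.+2%:R : R) <= n.+1%:R + n.+1%:R.
    by rewrite -natrD ler_nat -addn1 leq_add2l.
  apply: le_trans IH; rewrite mulrDl -mulrDr.
  by apply: ler_wpM2l => //; exact: ltW.
pose n := Num.truncn (h0 / d).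
have nd : (u n).2 < d.
  have : h0 / d < n.+1%:R by rewrite truncnS_gt.
  rewrite ltr_pdivrMr // => H.
  rewrite -(@ltr_pM2r _ n.+1%:R) ?ltr0n //.
  by apply: le_lt_trans (usize n) _; rewrite mulrC.
have [_ nPn] := ubad n; apply: nPn.
have [c1 c2 c3 c4] := udist 0%N n; rewrite addn0 in c1 c2 c3 c4.
apply: dP => //.
by rewrite upos nd.
Qed.

End square_induction.

(** * Riemann sums along the boundary of a square *)

Section complex_modulus.
Context {R : realType}.
Local Notation C := (Cplx R).

Definition rc (x : R) : C := real_complex R x.

HB.instance Definition _ := GRing.RMorphism.copy rc (real_complex R).

Definition ci : C := ('i%C : R[i]).

Lemma cplxE (z : C) : z = rc (complex.Re z) + ci * rc (complex.Im z).
Proof. exact: (@complexE R). Qed.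

Lemma ReD (z w : C) : complex.Re (z + w) = complex.Re z + complex.Re w.
Proof. by case: z w => a b [c d]. Qed.
Lemma ImD (z w : C) : complex.Im (z + w) = complex.Im z + complex.Im w.
Proof. by case: z w => a b [c d]. Qed.
Lemma ReN (z : C) : complex.Re (- z) = - complex.Re z.
Proof. by case: z. Qed.
Lemma ImN (z : C) : complex.Im (- z) = - complex.Im z.
Proof. by case: z. Qed.
Lemma Re_rcM (x : R) (z : C) : complex.Re (rc x * z) = x * complex.Re z.
Proof. by case: z => a b /=; rewrite mul0r subr0. Qed.
Lemma Im_rcM (x : R) (z : C) : complex.Im (rc x * z) = x * complex.Im z.
Proof. by case: z => a b /=; rewrite mul0r addr0. Qed.
Lemma Re_rc (x : R) : complex.Re (rc x) = x. Proof. by []. Qed.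
Lemma Im_rc (x : R) : complex.Im (rc x) = 0. Proof. by []. Qed.
Lemma Re_ciM (z : C) : complex.Re (ci * z) = - complex.Im z.
Proof. by case: z => a b /=; rewrite mul0r mul1r sub0r. Qed.
Lemma Im_ciM (z : C) : complex.Im (ci * z) = complex.Re z.
Proof. by case: z => a b /=; rewrite mul0r mul1r add0r. Qed.

Definition ReImE :=
  (ReD, ImD, ReN, ImN, Re_rcM, Im_rcM, Re_ciM, Im_ciM, Re_rc, Im_rc).

Lemma cmodM (z w : C) : cmod (z * w) = cmod z * cmod w.
Proof.
apply: (@complexI R); rewrite -cmodE normrM rmorphM /=.
by congr (_ * _); rewrite cmodE.
Qed.

Lemma cmodN (z : C) : cmod (- z) = cmod z.
Proof. by rewrite /cmod normrN. Qed.

Lemma cmod_rc (x : R) : cmod (rc x) = `|x|.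
Proof.
apply: (@complexI R); rewrite -cmodE.
by rewrite (normc_def (rc x : R[i])) /= expr0n addr0 sqrtr_sqr.
Qed.

Lemma cmod1 : cmod (1 : C) = 1.
Proof. by rewrite -[1 in LHS](rmorph1 rc) cmod_rc normr1. Qed.

Lemma cmod_ci : cmod ci = 1.
Proof.
apply: (@complexI R); rewrite -cmodE.
by rewrite (normc_def (ci : R[i])) /= expr0n expr1n add0r sqrtr1.
Qed.

Lemma cmodX (z : C) n : cmod (z ^+ n) = cmod z ^+ n.
Proof. by elim: n => [|n IH]; rewrite ?expr0 ?cmod1 // !exprS cmodM IH. Qed.

Lemma cmod_triangle (z w : C) : cmod z <= cmod w + cmod (z - w).
Proof. by have := cmodD w (z - w); rewrite addrC subrK. Qed.

Lemma cmodB (z w : C) : cmod (z - w) <= cmod z + cmod w.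
Proof. by rewrite -(cmodN w); exact: cmodD. Qed.

Lemma cmod_eq0 (z : C) : (cmod z == 0) = (z == 0).
Proof. by have := cmod_gt0 z; rewrite lt_def cmod_ge0 andbT => /negb_inj. Qed.

Lemma cmod_Re (z : C) : `|complex.Re z| <= cmod z.
Proof. by case: z => a b; case: (cmod_ge (a, b)). Qed.

Lemma cmod_Im (z : C) : `|complex.Im z| <= cmod z.
Proof. by case: z => a b; case: (cmod_ge (a, b)). Qed.

Lemma cmod_ReIm (z : C) : cmod z <= `|complex.Re z| + `|complex.Im z|.
Proof. by case: z => a b; exact: (cmod_le (a, b)). Qed.

Lemma rc_neq0 (x : R) : x != 0 -> rc x != 0.
Proof. by move=> x0; rewrite fmorph_eq0. Qed.

End complex_modulus.

Section goursat.
Context {R : realType}.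
Local Notation C := (Cplx R).
Implicit Types (f g : C -> C) (z v : C).

(** A Riemann sum for the mean of f along the segment from z to z + v, with 2^n
    sample points. The sum of rank n + 1 on a segment is exactly the mean of the
    sums of rank n on its two halves, so that Goursat's subdivision argument can
    be run on these sums, without passing to the integral. *)
Fixpoint dyadic_mean n f z v : C :=
  if n is n'.+1 then
    (dyadic_mean n' f z (v / 2) + dyadic_mean n' f (z + v / 2) (v / 2)) / 2
  else f z.

Lemma dyadic_mean_double n f z v : dyadic_mean n.+1 f z (v + v) =
  (dyadic_mean n f z v + dyadic_mean n f (z + v) v) / 2.
Proof.
by rewrite /= (_ : (v + v) / 2 = v) //; by field.
Qed.

(** A mean of values lying in a convex set lies in that set; this gives upper
    bounds on the modulus as well as lower bounds on a real or imaginary part. *)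
Lemma dyadic_mean_in (K : set C) n f z v :
  (forall a b, K a -> K b -> K ((a + b) / 2)) ->
  (forall t : R, 0 <= t <= 1 -> K (f (z + rc t * v))) ->
  K (dyadic_mean n f z v).
Proof.
move=> Kmid; elim: n z v => [|n IH] z v Kf /=.
  by have := Kf 0; rewrite rmorph0 mul0r addr0 lexx ler01; exact.
apply: Kmid; apply: IH => t /andP[t0 t1].
  have := Kf (t / 2); rewrite rmorphM /= fmorphV /= rmorph_nat.
  by rewrite -mulrA (mulrC 2^-1); apply; lra.
have := Kf ((1 + t) / 2); rewrite rmorphM /= fmorphV /= rmorph_nat rmorphD rmorph1.
rewrite (_ : z + (1 + rc t) / 2 * v = z + v / 2 + rc t * (v / 2)); last first.
  by field.
by apply; lra.
Qed.

Lemma dyadic_mean_ext n f g z v :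
  (forall t : R, 0 <= t <= 1 -> f (z + rc t * v) = g (z + rc t * v)) ->
  dyadic_mean n f z v = dyadic_mean n g z v.
Proof.
move=> fg; suff : dyadic_mean n f z v - dyadic_mean n g z v = 0 by move/subr0_eq.
have -> : dyadic_mean n f z v - dyadic_mean n g z v =
    dyadic_mean n (fun w => f w - g w) z v.
  elim: n z v {fg} => [//|n IH] z v /=; rewrite -!IH.
  by field.
apply: (@dyadic_mean_in [set 0]) => [a b -> ->|t t01 /=].
  by rewrite addr0 mul0r.
by rewrite fg // subrr.
Qed.

Lemma dyadic_mean_lin n f g c z v :
  dyadic_mean n (fun w => f w + c * g w) z v =
  dyadic_mean n f z v + c * dyadic_mean n g z v.
Proof.
elim: n z v => [//|n IH] z v /=; rewrite !IH.
by field.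
Qed.

Lemma dyadic_mean_bound n f z v M :
  (forall t : R, 0 <= t <= 1 -> cmod (f (z + rc t * v)) <= M) ->
  cmod (dyadic_mean n f z v) <= M.
Proof.
apply: (@dyadic_mean_in [set w | cmod w <= M]) => a b /= aM bM.
rewrite cmodM cmodV -(rmorph_nat rc) cmod_rc ger0_norm //.
by have := cmodD a b; lra.
Qed.

(** A Riemann sum for the counterclockwise integral of f along the boundary of
    the square with lower left corner z and side h. *)
Definition square_sum f n z (h : R) : C := rc h *
  (dyadic_mean n f z (rc h) + ci * dyadic_mean n f (z + rc h) (ci * rc h)
   - dyadic_mean n f (z + ci * rc h) (rc h)
   - ci * dyadic_mean n f z (ci * rc h)).

(** The four inner edges are shared by two quarters, which sample them at the
    same points and traverse them in opposite directions. *)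
Lemma square_sum_double f n z h : square_sum f n.+1 z (h + h) =
  square_sum f n z h + square_sum f n (z + rc h) h +
  square_sum f n (z + ci * rc h) h +
  square_sum f n (z + rc h + ci * rc h) h.
Proof.
have rcD : rc (h + h) = rc h + rc h by rewrite rmorphD.
rewrite /square_sum rcD !(mulrDr ci) !dyadic_mean_double !addrA.
rewrite (addrAC (z + ci * rc h) (ci * rc h)) !(addrAC z (ci * rc h) (rc h)).
rewrite (addrAC (z + rc h) (ci * rc h) (rc h)).
by field.
Qed.

(** Already the crudest sum, of rank 0, vanishes on affine functions, and
    subdivision propagates this to all ranks. *)
Lemma square_sum_affine n z h a b :
  square_sum (fun w => a + b * w) n z h = 0.
Proof.
elim: n z h => [|n IH] z h; last first.
  have -> : h = h / 2 + h / 2 by lra.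
  by rewrite square_sum_double !IH !addr0.
by rewrite /square_sum /=; ring.
Qed.

End goursat.

Section goursat_lemma.
Context {R : realType}.
Local Notation C := (Cplx R).
Implicit Types (f g : C -> C) (z w v : C) (x y h k a M : R).

Definition square (x y h : R) : set C :=
  [set w | x <= complex.Re w <= x + h /\ y <= complex.Im w <= y + h].

Definition square_int (x y h : R) : set C :=
  [set w | x < complex.Re w < x + h /\ y < complex.Im w < y + h].

Definition square_bd (x y h : R) : set C := square x y h `\` square_int x y h.

Lemma square_int_sub x y h : square_int x y h `<=` square x y h.
Proof. by move=> w [/andP[a b] /andP[c d]]; split; apply/andP; split; exact: ltW. Qed.

Lemma Im_mkC (x y : R) : complex.Im (mkC (x, y)) = y. Proof. by []. Qed.

Lemma mkC_shiftR (x y k : R) : mkC (x, y) + rc k = mkC (x + k, y).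
Proof. by rewrite /mkC /rc /GRing.add /= addr0. Qed.

Lemma mkC_shiftI (x y k : R) : mkC (x, y) + ci * rc k = mkC (x, y + k).
Proof.
by rewrite [LHS]cplxE [RHS]cplxE !ReImE !Im_mkC subr0.
Qed.

Section sides.
Variables (x y h : R).
Hypothesis h0 : 0 < h.
Let z := mkC (x, y).

Let scaled (t : R) : 0 <= t -> t <= 1 -> 0 <= t * h /\ t * h <= h.
Proof. by move=> t0 t1; rewrite ler_piMl ?mulr_ge0 // ltW. Qed.

Lemma bottom_bd (t : R) : 0 <= t <= 1 -> square_bd x y h (z + rc t * rc h).
Proof.
move=> /andP[t0 t1]; rewrite /z -rmorphM mkC_shiftR; split => [|[] /=].
  by have [th0 th1] := scaled t0 t1; split; apply/andP; split => /=; lra.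
by rewrite ltxx.
Qed.

Lemma top_bd (t : R) :
  0 <= t <= 1 -> square_bd x y h (z + ci * rc h + rc t * rc h).
Proof.
move=> /andP[t0 t1]; rewrite /z mkC_shiftI -rmorphM mkC_shiftR; split => [|[] /=].
  by have [th0 th1] := scaled t0 t1; split; apply/andP; split => /=; lra.
by rewrite ltxx andbF.
Qed.

Lemma left_bd (t : R) :
  0 <= t <= 1 -> square_bd x y h (z + rc t * (ci * rc h)).
Proof.
move=> /andP[t0 t1]; rewrite /z mulrCA -rmorphM mkC_shiftI; split => [|[] /=].
  by have [th0 th1] := scaled t0 t1; split; apply/andP; split => /=; lra.
by rewrite ltxx.
Qed.

Lemma right_bd (t : R) :
  0 <= t <= 1 -> square_bd x y h (z + rc h + rc t * (ci * rc h)).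
Proof.
move=> /andP[t0 t1]; rewrite /z mkC_shiftR mulrCA -rmorphM mkC_shiftI.
split => [|[] /=].
  by have [th0 th1] := scaled t0 t1; split; apply/andP; split => /=; lra.
by rewrite ltxx andbF.
Qed.

Lemma square_sum_ext n f g : {in square_bd x y h, f =1 g} ->
  square_sum f n z h = square_sum g n z h.
Proof.
move=> fg; rewrite /square_sum.
rewrite (@dyadic_mean_ext _ n f g z (rc h)); last first.
  by move=> t t01; apply/fg/mem_set/bottom_bd.
rewrite (@dyadic_mean_ext _ n f g (z + rc h)); last first.
  by move=> t t01; apply/fg/mem_set/right_bd.
rewrite (@dyadic_mean_ext _ n f g (z + _ * _)); last first.
  by move=> t t01; apply/fg/mem_set/top_bd.
rewrite (@dyadic_mean_ext _ n f g z (_ * _)) //.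
by move=> t t01; apply/fg/mem_set/left_bd.
Qed.

Lemma square_sum_bound n f M : (forall w, square_bd x y h w -> cmod (f w) <= M) ->
  cmod (square_sum f n z h) <= 4 * h * M.
Proof.
move=> fM; rewrite /square_sum cmodM cmod_rc gtr0_norm //.
have b1 := @dyadic_mean_bound _ n f z (rc h) M (fun t ht => fM _ (bottom_bd ht)).
have b2 := @dyadic_mean_bound _ n f _ _ M (fun t ht => fM _ (right_bd ht)).
have b3 := @dyadic_mean_bound _ n f _ _ M (fun t ht => fM _ (top_bd ht)).
have b4 := @dyadic_mean_bound _ n f _ _ M (fun t ht => fM _ (left_bd ht)).
rewrite [4 * h]mulrC -mulrA ler_pM2l //.
apply: le_trans (cmodB _ _) _; rewrite [in X in _ + X]cmodM cmod_ci mul1r.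
apply: le_trans (lerD (cmodB _ _) b4) _.
apply: le_trans (lerD (lerD (cmodD _ _) b3) (lexx _)) _.
by rewrite cmodM cmod_ci mul1r; lra.
Qed.

End sides.

Lemma square_sum_lin n f g c z h :
  square_sum (fun w => f w + c * g w) n z h =
  square_sum f n z h + c * square_sum g n z h.
Proof. by rewrite /square_sum !dyadic_mean_lin; ring. Qed.

Lemma derivable_approx f z : derivable f z 1 ->
  forall e : R, 0 < e -> exists2 d : R, 0 < d & forall w, cmod (w - z) < d ->
    cmod (f w - f z - derive1 f z * (w - z)) <= e * cmod (w - z).
Proof.
move=> df e e0; rewrite derive1E.
have /cvgrPdist_lt /(_ (rc e)) :
    (h^-1 *: (f (h *: 1 + z) - f z)) @[h --> 0^'] --> 'D_1 f z.
  exact: df.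
have re0 : (0 : C) < rc e by rewrite (ltcR 0).
move=> /(_ re0) /nbhs_ballP [r /= r0 rP].
have [d d0 dP] : exists2 d : R, 0 < d & forall h : C, cmod h < d -> ball (0:C) r h.
  have /cnbhsP [d d0 dP] : nbhs (0 : C) (ball 0 r) by exact: nbhsx_ballx.
  by exists d => // h hd; apply: dP; rewrite subr0.
exists d => // w wd; have [->|wz] := eqVneq w z.
  by rewrite !subrr mulr0 subr0 cmod0 mulr0.
have wz0 : w - z != 0 by rewrite subr_eq0.
have /= := rP (w - z) (dP _ wd) wz0.
rewrite /GRing.scale /= mulr1 subrK cmodP => H.
have -> : f w - f z - 'D_1 f z * (w - z) =
    - ('D_1 f z - (w - z)^-1 * (f w - f z)) * (w - z).
  by field.
by rewrite cmodM cmodN ler_wpM2r ?cmod_ge0 // ltW.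
Qed.

(** A unit mass just to the right of a and another just to the left of a, seen
    from [x, x + h]: additive under bisection even when a is the midpoint, and at
    least 1 as soon as a belongs to the closed interval. *)
Definition half_weight (a x h : R) : R :=
  (x <= a < x + h)%R%:R + (x < a <= x + h)%R%:R.

Lemma half_weight_double a x k : 0 < k ->
  half_weight a x (k + k) = half_weight a x k + half_weight a (x + k) k.
Proof.
move=> k0; rewrite /half_weight addrA.
case: (ltgtP x a); case: (ltgtP a (x + k)); case: (ltgtP a (x + k + k)) => * /=;
  lra.
Qed.

Lemma half_weight_ge0 a x h : 0 <= half_weight a x h.
Proof. by rewrite addr_ge0 // ler0n. Qed.

Lemma half_weight_ge1 a x h : 0 < h -> x <= a <= x + h -> 1 <= half_weight a x h.
Proof.
rewrite /half_weight => h0 /andP[xa ah]; rewrite xa ah andbT /=.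
have [axh|axh] := ltP a (x + h); first by rewrite lerDl ler0n.
rewrite add0r.
by have -> : x < a by lra.
Qed.

End goursat_lemma.

(** * Goursat's theorem *)

Section goursat_theorem.
Context {R : realType}.
Local Notation C := (Cplx R).
Implicit Types (f g : C -> C) (z w v p : C) (E : seq C) (x y h k M : R).

Definition point_weight E (x y h : R) : R :=
  \sum_(a <- E) half_weight (complex.Re a) x h * half_weight (complex.Im a) y h.

Lemma point_weight_double E x y k : 0 < k -> point_weight E x y (k + k) =
  point_weight E x y k + point_weight E (x + k) y k + point_weight E x (y + k) k
  + point_weight E (x + k) (y + k) k.
Proof.
move=> k0; rewrite /point_weight -!big_split /=; apply: eq_bigr => a _.
by rewrite !half_weight_double //; ring.
Qed.

Lemma point_weight_ge0 E x y h : 0 <= point_weight E x y h.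
Proof. by apply: sumr_ge0 => a _; rewrite mulr_ge0 // half_weight_ge0. Qed.

Lemma point_weight_ge1 E x y h a : 0 < h -> a \in E -> square x y h a ->
  1 <= point_weight E x y h.
Proof.
move=> h0 aE [ax ay]; rewrite /point_weight (big_rem a) //=.
apply: le_trans (_ : half_weight (complex.Re a) x h *
  half_weight (complex.Im a) y h <= _).
  by rewrite mulr_ege1 // half_weight_ge1.
by rewrite lerDl sumr_ge0 // => b _; rewrite mulr_ge0 // half_weight_ge0.
Qed.

Lemma square_diam x y h w w' : square x y h w -> square x y h w' ->
  cmod (w - w') <= 2 * h.
Proof.
move=> [/andP[a b] /andP[c d]] [/andP[a' b'] /andP[c' d']].
apply: le_trans (cmod_ReIm _) _; rewrite !ReImE.
have : `|complex.Re w - complex.Re w'| <= h by rewrite ler_norml; lra.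
have : `|complex.Im w - complex.Im w'| <= h by rewrite ler_norml; lra.
by lra.
Qed.

(** Goursat's theorem for a bounded function, differentiable off a finite set E.
    Near a point of differentiability f is affine up to an error o(h), so that a
    square of side h contributes o(h^2), a small multiple of its area. Near a
    point of E a small square contributes O(h), a small multiple of the weight
    of that point. Area and weight being additive under subdivision, these local
    bounds add up to a global one. *)
Lemma goursat f E (x0 y0 h0 : R) M : 0 < h0 ->
  (forall w, square x0 y0 h0 w -> cmod (f w) <= M) ->
  (forall w, square x0 y0 h0 w -> w \notin E -> derivable f w 1) ->
  forall e : R, 0 < e -> exists N, forall n, (N <= n)%N ->
    cmod (square_sum f n (mkC (x0, y0)) h0) <= e.
Proof.
move=> h00 fM df e e0.
have [e1 e10 e1E] : exists2 e1 : R, 0 < e1 &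
    e1 * (h0 ^+ 2 + point_weight E x0 y0 h0) = e.
  have K0 : 0 < h0 ^+ 2 + point_weight E x0 y0 h0.
    by rewrite ltr_pwDl ?exprn_gt0 // point_weight_ge0.
  by eexists; [exact: divr_gt0 e0 K0|rewrite divfK // gt_eqF].
have M0 : 0 <= M.
  apply: le_trans (fM (mkC (x0, y0)) _); first exact: cmod_ge0.
  by split => /=; rewrite lexx lerDl ltW.
rewrite -e1E; apply: (square_induction (P := fun x y h => exists N, forall n,
    (N <= n)%N -> cmod (square_sum f n (mkC (x, y)) h)
      <= e1 * (h ^+ 2 + point_weight E x y h))) => //.
  move=> x y k k0 [N1 P1] [N2 P2] [N3 P3] [N4 P4].
  exists (maxn (maxn N1 N2) (maxn N3 N4)).+1 => -[//|n]; rewrite ltnS !geq_max.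
  move=> /andP[/andP[/P1 H1 /P2 H2] /andP[/P3 H3 /P4 H4]].
  rewrite square_sum_double point_weight_double //.
  rewrite !(mkC_shiftR, mkC_shiftI).
  apply: le_trans (cmodD _ _) _; apply: le_trans (lerD (cmodD _ _) H4) _.
  apply: le_trans (lerD (lerD (cmodD _ _) H3) (lexx _)) _.
  apply: le_trans (lerD (lerD (lerD H1 H2) (lexx _)) (lexx _)) _.
  by rewrite le_eqVlt; apply/orP; left; apply/eqP; ring.
move=> a b a_in b_in; pose w := mkC (a, b).
have [wE|wE] := boolP (w \in E).
  exists (e1 / (4 * M + 1)); first by rewrite divr_gt0 //; lra.
  move=> x y h /andP[h1 h2] xa ya X1 X2 Y1 Y2; exists 0%N => n _.
  have sub v : square_bd x y h v -> square x0 y0 h0 v.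
    by move=> [[/andP[? ?] /andP[? ?]] _]; split; lra.
  apply: le_trans (square_sum_bound (M := M) _ _ _) _ => //.
    by move=> v /sub; exact: fM.
  apply: le_trans (_ : e1 * 1 <= _).
    rewrite mulr1; move: h2; rewrite ltr_pdivlMr; last by lra.
    by rewrite (_ : 4 * h * M = h * (4 * M)); [rewrite mulrDr mulr1; lra|ring].
  rewrite ler_pM2l // ler_wpDl ?sqr_ge0 //.
  exact: (point_weight_ge1 h1 wE).
have wsq : square x0 y0 h0 w by [].
have e18 : 0 < e1 / 8 by rewrite divr_gt0.
have [d d0 dP] := derivable_approx (df w wsq wE) e18.
exists (d / 2); first by rewrite divr_gt0.
move=> x y h /andP[h1 h2] xa ya X1 X2 Y1 Y2; exists 0%N => n _.
pose l := derive1 f w.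
rewrite (_ : square_sum f n _ h = square_sum (fun v => f v +
    (-1) * ((f w - l * w) + l * v)) n (mkC (x, y)) h); last first.
  by rewrite square_sum_lin square_sum_affine mulr0 addr0.
apply: le_trans (square_sum_bound (M := e1 / 8 * (2 * h)) _ _ _) _ => //.
  move=> v [vsq _]; have vw := square_diam vsq (conj xa ya : square x y h w).
  have -> : f v + -1 * (f w - l * w + l * v) = f v - f w - l * (v - w) by ring.
  apply: le_trans (dP v _) _; first by lra.
  by rewrite ler_pM2l.
rewrite (_ : 4 * h * _ = e1 * h ^+ 2); last by field.
by rewrite ler_pM2l // lerDl point_weight_ge0.
Qed.

(** At z = p this is 0, as 0^-1 = 0. *)
Definition slope f p z : C := (f z - f p) / (z - p).

Lemma slope_bounded f p M (A : set C) : derivable f p 1 ->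
  (forall w, A w -> cmod (f w) <= M) ->
  exists M1, forall w, A w -> cmod (slope f p w) <= M1.
Proof.
move=> df fM; have [d d0 dP] := derivable_approx df ltr01.
exists (Num.max (cmod (derive1 f p) + 1) ((M + cmod (f p)) / d)) => w Aw.
rewrite le_max; have [wd|wd] := ltP (cmod (w - p)) d.
  apply/orP; left; have [->|wp] := eqVneq w p.
    by rewrite /slope !subrr mul0r cmod0 addr_ge0 ?cmod_ge0.
  have wp0 : w - p != 0 by rewrite subr_eq0.
  apply: le_trans (cmod_triangle _ (derive1 f p)) _; rewrite lerD2l.
  have -> : slope f p w - derive1 f p =
      (f w - f p - derive1 f p * (w - p)) / (w - p) by rewrite /slope; field.
  rewrite cmodM cmodV ler_pdivrMr ?cmod_gt0 //; exact: dP.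
apply/orP; right; rewrite /slope cmodM cmodV ler_pM ?cmod_ge0 //.
- by rewrite invr_ge0 cmod_ge0.
- by apply: le_trans (cmodB _ _) _; rewrite lerD2r fM.
- by rewrite lef_pV2 // posrE; apply: lt_le_trans wd.
Qed.

Lemma derivable_slope f p w : w != p -> derivable f w 1 ->
  derivable (slope f p) w 1.
Proof.
move=> wp df.
have d1 : derivable (fun z => f z - f p) w 1.
  exact: (derivableB df (derivable_cst (f p) w 1)).
have d2 : derivable (fun z => z - p) w 1.
  exact: (derivableB (@derivable_id _ _ w 1) (derivable_cst p w 1)).
have wp0 : w - p != 0 by rewrite subr_eq0.
exact: (@derivableM C C _ (fun z => (z - p)^-1) _ _ d1
  (@derivableV C C (fun z => z - p) _ _ wp0 d2)).
Qed.

End goursat_theorem.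

(** * The maximum principle *)

Section maximum_principle.
Context {R : realType}.
Local Notation C := (Cplx R).
Implicit Types (f g : C -> C) (z w v p : C) (E : seq C) (x y h M e d : R).

Lemma cmod_sqr z : cmod z ^+ 2 = complex.Re z ^+ 2 + complex.Im z ^+ 2.
Proof.
rewrite /cmod (normc_def (z : R[i])) /= sqr_sqrtr //.
by rewrite addr_ge0 ?sqr_ge0.
Qed.

Lemma Re_inv z : complex.Re z^-1 = complex.Re z / cmod z ^+ 2.
Proof. by rewrite cmod_sqr; case: z. Qed.

Lemma Im_inv z : complex.Im z^-1 = - complex.Im z / cmod z ^+ 2.
Proof. by rewrite cmod_sqr; case: z => a b; rewrite mulNr. Qed.

Lemma square_bd_away x y h p : square_int x y h p ->
  exists2 d, 0 < d & forall w, square_bd x y h w -> d <= cmod (w - p).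
Proof.
move=> [/andP[a b] /andP[c e]].
exists (Num.min (Num.min (complex.Re p - x) (x + h - complex.Re p))
                (Num.min (complex.Im p - y) (y + h - complex.Im p))).
  by rewrite !lt_min !subr_gt0 a b c e.
move=> w [_ nint]; rewrite leNgt !lt_min.
apply/negP => /andP[/andP[H1 H2] /andP[H3 H4]].
have := cmod_Re (w - p); have := cmod_Im (w - p); rewrite !ReImE !ler_norml.
move=> /andP[H5 H6] /andP[H7 H8]; apply: nint.
by split; apply/andP; split; lra.
Qed.

(** The integral is 2 i pi. All sides are seen from p under positive angles, so
    their contributions have positive imaginary parts: at least h / (2h)^2 times
    the distance from p to the side, as |w - p| <= 2h. The four distances add up
    to 2h. *)
Lemma square_sum_inv x y h p n : 0 < h -> square_int x y h p ->
  2^-1 <= complex.Im (square_sum (fun w => (w - p)^-1) n (mkC (x, y)) h).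
Proof.
move=> h0 pint; have [/andP[a b] /andP[c e]] := pint.
have [d d0 dP] := square_bd_away pint.
set f := fun w => (w - p)^-1.
have size w : square_bd x y h w -> 0 < cmod (w - p) ^+ 2 <= 4 * h ^+ 2.
  move=> wbd; have wd := dP _ wbd; have [wsq _] := wbd.
  rewrite exprn_gt0 /=; last exact: lt_le_trans wd.
  rewrite (_ : 4 * h ^+ 2 = (2 * h) ^+ 2); last by ring.
  have := square_diam wsq (square_int_sub pint).
  by move=> H; rewrite ler_pXn2r // nnegrE; [exact: cmod_ge0|lra].
have quot w (s t : R) : square_bd x y h w -> 0 < s -> s <= t ->
    s / (4 * h ^+ 2) <= t / cmod (w - p) ^+ 2.
  move=> /size/andP[w1 w2] s0 st; apply: ler_pM; rewrite ?(ltW s0) //.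
    by rewrite invr_ge0 mulr_ge0 // sqr_ge0.
  by rewrite lef_pV2 // posrE // mulr_gt0 // exprn_gt0.
rewrite /square_sum Im_rcM !ReImE.
set m1 := dyadic_mean _ _ _ _; set m2 := dyadic_mean _ _ _ _.
set m3 := dyadic_mean _ _ _ _; set m4 := dyadic_mean _ _ _ _.
have half2 (u : C) : u / 2 = rc 2^-1 * u by rewrite fmorphV rmorph_nat mulrC.
have H1 : (complex.Im p - y) / (4 * h ^+ 2) <= complex.Im m1.
  apply: (@dyadic_mean_in _ [set w | _ <= complex.Im w]) => [u v /= Hu Hv|t t01 /=].
    by rewrite half2 Im_rcM ImD; lra.
  rewrite /f Im_inv; apply: quot; rewrite ?subr_gt0 //; first exact: bottom_bd.
  by rewrite -rmorphM mkC_shiftR !ReImE //=; lra.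
have H2 : (x + h - complex.Re p) / (4 * h ^+ 2) <= complex.Re m2.
  apply: (@dyadic_mean_in _ [set w | _ <= complex.Re w]) => [u v /= Hu Hv|t t01 /=].
    by rewrite half2 Re_rcM ReD; lra.
  rewrite /f Re_inv; apply: quot; rewrite ?subr_gt0 //; first exact: right_bd.
  by rewrite mulrCA -rmorphM mkC_shiftR mkC_shiftI !ReImE //=; lra.
have H3 : (y + h - complex.Im p) / (4 * h ^+ 2) <= - complex.Im m3.
  apply: (@dyadic_mean_in _ [set w | _ <= - complex.Im w]) => [u v /= Hu Hv|t t01 /=].
    by rewrite half2 Im_rcM ImD; lra.
  rewrite /f Im_inv mulNr opprK; apply: quot; rewrite ?subr_gt0 //; first exact: top_bd.
  by rewrite -rmorphM mkC_shiftI mkC_shiftR !ReImE //=; lra.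
have H4 : (complex.Re p - x) / (4 * h ^+ 2) <= - complex.Re m4.
  apply: (@dyadic_mean_in _ [set w | _ <= - complex.Re w]) => [u v /= Hu Hv|t t01 /=].
    by rewrite half2 Re_rcM ReD; lra.
  rewrite /f Re_inv -mulNr; apply: quot; rewrite ?subr_gt0 //; first exact: left_bd.
  by rewrite mulrCA -rmorphM mkC_shiftI !ReImE //=; lra.
apply: le_trans (_ : h * ((complex.Im p - y) / (4 * h ^+ 2) +
  (x + h - complex.Re p) / (4 * h ^+ 2) + (y + h - complex.Im p) / (4 * h ^+ 2) +
  (complex.Re p - x) / (4 * h ^+ 2)) <= _); last by rewrite ler_pM2l //; lra.
rewrite le_eqVlt; apply/orP; left; apply/eqP.
by field; rewrite gt_eqF.
Qed.

(** The m-th root of the constant K tends to 1. *)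
Lemma ler_of_powers (a b K : R) : 0 <= b ->
  (forall m, a ^+ m <= K * b ^+ m) -> a <= b.
Proof.
move=> b0 H; rewrite leNgt; apply/negP => ab.
have {b0}[b0|b0] : b = 0 \/ 0 < b.
  by case: (ltgtP b 0) b0 => // [b1 _|->]; [right|left].
  by have := H 1%N; rewrite b0 !expr1 mulr0 leNgt -b0 ab.
pose r := a / b - 1; have r0 : 0 < r by rewrite subr_gt0 ltr_pdivlMr ?mul1r.
have bern m : 1 + m%:R * r <= (a / b) ^+ m.
  elim: m => [|m IH]; first by rewrite mul0r addr0.
  have rE : a / b = 1 + r by rewrite /r addrC subrK.
  rewrite exprS; apply: le_trans (_ : (1 + r) * (1 + m%:R * r) <= _).
    have -> : (1 + r) * (1 + m%:R * r) = 1 + (m%:R + 1) * r + m%:R * r * r.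
      by ring.
    by rewrite natr1 lerDl !mulr_ge0 // ltW.
  by rewrite {1}rE ler_pM2l // addr_gt0.
have up m : 1 + m%:R * r <= K.
  apply: le_trans (bern m) _; rewrite expr_div_n ler_pdivrMr ?exprn_gt0 //.
have := up (Num.truncn (K / r)).+1.
have : K / r < (Num.truncn (K / r)).+1%:R by rewrite truncnS_gt.
rewrite ltr_pdivrMr // => KN NK.
have : (Num.truncn (K / r)).+1%:R * r <= K by apply: le_trans NK; rewrite lerDr.
by rewrite leNgt KN.
Qed.

Lemma derivable_exp f m w : derivable f w 1 ->
  derivable (fun z => f z ^+ m) w 1.
Proof.
move=> df; elim: m => [|m IH].
  have -> : (fun z => f z ^+ 0) = cst 1 by apply/funext => z; rewrite expr0.
  exact: derivable_cst.
have -> : (fun z => f z ^+ m.+1) = (fun z => f z * f z ^+ m).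
  by apply/funext => z; rewrite exprS.
exact: (@derivableM C C f (fun z => f z ^+ m) w 1 df IH).
Qed.

(** On the boundary f w / (w - p) = slope f p w + f p / (w - p); by Goursat's
    theorem the first term integrates to 0, so Cauchy's formula holds
    approximately and bounds f p by a constant times the maximum of |f| on the
    boundary. *)
Lemma cauchy_estimate f E x y h M M0 p d : 0 < h ->
  (forall w, square x y h w -> cmod (f w) <= M0) ->
  (forall w, square x y h w -> w \notin E -> derivable f w 1) ->
  (forall w, square_bd x y h w -> cmod (f w) <= M) ->
  square_int x y h p -> p \notin E ->
  0 < d -> (forall w, square_bd x y h w -> d <= cmod (w - p)) ->
  cmod (f p) <= 8 * h / d * M.
Proof.
move=> h0 fM0 df fM pint pE d0 dP; apply/ler_addgt0Pr => e e0.
have pd := df _ (square_int_sub pint) pE.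
have [M1 M1P] := slope_bounded pd fM0.
have [||N NP] := @goursat _ (slope f p) (p :: E) x y h M1 h0 M1P _ (e / 2).
- move=> w wsq; rewrite inE negb_or => /andP[wp wE].
  exact (derivable_slope wp (df w wsq wE)).
- by rewrite divr_gt0.
have {NP} NP := NP N (leqnn N).
have ne w : square_bd x y h w -> w - p != 0.
  by move=> /dP wd; rewrite -cmod_gt0; exact: lt_le_trans wd.
have decomp : square_sum (fun w => f w / (w - p)) N (mkC (x, y)) h =
    square_sum (slope f p) N (mkC (x, y)) h +
    f p * square_sum (fun w => (w - p)^-1) N (mkC (x, y)) h.
  rewrite -square_sum_lin; apply: square_sum_ext => // w /set_mem /ne wp.
  by rewrite /slope; field.
have up : cmod (square_sum (fun w => f w / (w - p)) N (mkC (x, y)) h) <=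
    4 * h * (M / d).
  apply: square_sum_bound => // w wbd; rewrite cmodM cmodV.
  apply: ler_pM; rewrite ?invr_ge0 ?cmod_ge0 //; first exact: fM.
  rewrite lef_pV2 ?posrE ?dP //; exact: lt_le_trans (dP _ wbd).
have lo := square_sum_inv N h0 pint.
move: decomp lo up NP; set A := square_sum _ _ _ _; set B := square_sum _ _ _ _.
set D := square_sum _ _ _ _ => decomp lo up NP.
have : cmod (f p) * 2^-1 <= cmod (f p * D).
  rewrite cmodM ler_wpM2l ?cmod_ge0 //; apply: le_trans lo _.
  by apply: le_trans (ler_norm _) (cmod_Im _).
have -> : f p * D = A - B by rewrite decomp; ring.
move=> H; have := le_trans H (cmodB A B).
rewrite (_ : 8 * h / d * M = 2 * (4 * h * (M / d))); last by field; rewrite gt_eqF.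
by lra.
Qed.

(** The constant in Cauchy's estimate does not depend on f: applied to the powers
    f ^+ m, it can be replaced by its m-th root, hence by 1. *)
Lemma maximum_principle f E x y h M M0 p : 0 < h ->
  (forall w, square x y h w -> cmod (f w) <= M0) ->
  (forall w, square x y h w -> w \notin E -> derivable f w 1) ->
  (forall w, square_bd x y h w -> cmod (f w) <= M) ->
  square_int x y h p -> p \notin E ->
  cmod (f p) <= M.
Proof.
move=> h0 fM0 df fM pint pE; have [d d0 dP] := square_bd_away pint.
have M_ge0 : 0 <= M.
  apply: le_trans (cmod_ge0 _) (fM _ (@bottom_bd _ x y h h0 0 _)).
  by rewrite lexx ler01.
apply: (@ler_of_powers _ _ (8 * h / d)) => // m; rewrite -cmodX.
have fM0' w : square x y h w -> cmod (f w ^+ m) <= M0 ^+ m.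
  move=> /fM0 wM; rewrite cmodX; apply: lerXn2r; rewrite ?nnegrE ?cmod_ge0 //.
  by apply: le_trans wM; exact: cmod_ge0.
have fM' w : square_bd x y h w -> cmod (f w ^+ m) <= M ^+ m.
  by move=> /fM wM; rewrite cmodX; apply: lerXn2r; rewrite ?nnegrE ?cmod_ge0.
have df' w : square x y h w -> w \notin E -> derivable (fun z => f z ^+ m) w 1.
  by move=> wsq wE; exact (@derivable_exp f m w (df w wsq wE)).
exact (cauchy_estimate h0 fM0' df' fM' pint pE d0 dP).
Qed.

End maximum_principle.

(** * Zeros and local inverses of holomorphic functions *)

Section local_theory.
Context {R : realType}.
Local Notation C := (Cplx R).
Implicit Types (F f g : C -> C) (z w v p q : C) (E : seq C) (x y h M e d r c : R).

Lemma maximum_principle_annulus f E p r M M0 q : 0 < r ->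
  (forall w, cmod (w - p) <= 2 * r -> cmod (f w) <= M0) ->
  (forall w, cmod (w - p) <= 2 * r -> w \notin E -> derivable f w 1) ->
  (forall w, r <= cmod (w - p) <= 2 * r -> cmod (f w) <= M) ->
  cmod (q - p) < r -> q \notin E -> cmod (f q) <= M.
Proof.
move=> r0 fM0 df fM qr qE.
pose x := complex.Re p - r; pose y := complex.Im p - r.
have sub w : square x y (r + r) w -> cmod (w - p) <= 2 * r.
  move=> [/andP[a b] /andP[c d]]; apply: le_trans (cmod_ReIm _) _.
  rewrite mulr_natl mulr2n !ReImE lerD // ler_norml; rewrite /x /y in a b c d; lra.
have int w : cmod (w - p) < r -> square_int x y (r + r) w.
  move=> wr; have := le_lt_trans (cmod_Re _) wr; have := le_lt_trans (cmod_Im _) wr.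
  rewrite !ReImE !ltr_norml => /andP[a b] /andP[c d].
  by split; apply/andP; rewrite /x /y; split; lra.
have h0 : 0 < r + r by rewrite addr_gt0.
have fM0' w : square x y (r + r) w -> cmod (f w) <= M0 by move=> /sub; exact: fM0.
have df' w : square x y (r + r) w -> w \notin E -> derivable f w 1.
  by move=> /sub wp wE; exact (df w wp wE).
have fM' w : square_bd x y (r + r) w -> cmod (f w) <= M.
  move=> [wsq wint]; apply: fM; rewrite (sub _ wsq) andbT leNgt.
  by apply/negP => /int.
exact (maximum_principle h0 fM0' df' fM' (int _ qr) qE).
Qed.

Lemma derivable_near_bounded f p : derivable f p 1 ->
  exists2 d, 0 < d & exists M, forall w, cmod (w - p) < d -> cmod (f w) <= M.
Proof.
move=> df; have [d d0 dP] := derivable_approx df ltr01.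
exists d => //; exists (cmod (f p) + (cmod (derive1 f p) * d + d)) => w wd.
have wd' := ltW wd.
have -> : f w = f p + (derive1 f p * (w - p) + (f w - f p - derive1 f p * (w - p))).
  by ring.
apply: le_trans (cmodD _ _) _; rewrite lerD2l.
apply: le_trans (cmodD _ _) _; apply: lerD.
  by rewrite cmodM ler_wpM2l ?cmod_ge0.
by apply: le_trans (dP _ wd) _; rewrite mul1r.
Qed.

(** Dividing by (w - a) at a simple or multiple zero a leaves a bounded function,
    differentiable off a: exactly what the maximum principle tolerates. *)
Lemma divide_zeros F p r M0 s : uniq s ->
  (forall w, cmod (w - p) <= r -> cmod (F w) <= M0) ->
  (forall w, cmod (w - p) <= r -> derivable F w 1) ->
  (forall a, a \in s -> cmod (a - p) <= r /\ F a = 0) ->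
  exists g, [/\ exists M, forall w, cmod (w - p) <= r -> cmod (g w) <= M,
    forall w, cmod (w - p) <= r -> w \notin s -> derivable g w 1 &
    forall w, F w = g w * \prod_(a <- s) (w - a)].
Proof.
move=> us FM dF; elim: s us => [_ _|a s IH /= /andP[as_ us] Fs].
  exists F; split; [by exists M0|by move=> w wr _; exact (dF w wr)|].
  by move=> w; rewrite big_nil mulr1.
have [g [[M gM] dg Fg]] := IH us (fun b bs => Fs b (mem_behead (s := a :: s) bs)).
have [ar Fa] := Fs a (mem_head _ _).
have ga : g a = 0.
  move/eqP: (Fg a); rewrite Fa eq_sym mulf_eq0 => /orP[/eqP //|].
  rewrite prodf_seq_eq0 => /hasP[b bs /=]; rewrite subr_eq0 => /eqP ab.
  by rewrite ab bs in as_.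
exists (slope g a); split.
- by have := @slope_bounded _ g a M [set w | cmod (w - p) <= r] (dg a ar as_) gM.
- move=> w wr; rewrite inE negb_or => /andP[wa ws].
  exact (derivable_slope wa (dg w wr ws)).
- move=> w; rewrite big_cons Fg /slope ga subr0.
  have [->|wa] := eqVneq w a; first by rewrite ga !mul0r.
  have wa0 : w - a != 0 by rewrite subr_eq0.
  by field.
Qed.

(** Divide F by the product of N zeros very close to p and apply the maximum
    principle to the quotient on a disc of fixed radius: this bounds F near p by
    a multiple of 2^-N, for every N. *)
Lemma zero_near_limit_of_zeros F p d0 : 0 < d0 ->
  (forall w, cmod (w - p) < d0 -> derivable F w 1) ->
  (forall d, 0 < d -> exists w, 0 < cmod (w - p) < d /\ F w = 0) ->
  exists2 d, 0 < d & forall w, cmod (w - p) < d -> F w = 0.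
Proof.
move=> d00 dF acc.
have pp0 : cmod (p - p) < d0 by rewrite subrr cmod0.
have [d1 d10 [M0 M0P]] := derivable_near_bounded (dF p pp0).
pose r := Num.min d0 d1 / 4.
have m0 : 0 < Num.min d0 d1 by rewrite lt_min d00.
have r0 : 0 < r by rewrite divr_gt0.
have rd : 2 * r < Num.min d0 d1 by rewrite /r; lra.
have FM w : cmod (w - p) <= 2 * r -> cmod (F w) <= M0.
  move=> wr; apply: M0P; apply: le_lt_trans wr (lt_le_trans rd _).
  by rewrite ge_min lexx orbT.
have dF' w : cmod (w - p) <= 2 * r -> derivable F w 1.
  move=> wr; have wd0 : cmod (w - p) < d0.
    by apply: le_lt_trans wr (lt_le_trans rd _); rewrite ge_min lexx.
  exact (dF w wd0).
have many N : exists2 s : seq C, uniq s /\ size s = N & exists2 d, 0 < d &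
    forall a, a \in s -> d <= cmod (a - p) /\ cmod (a - p) < r / 8 /\ F a = 0.
  elim: N => [|N [s [us sN] [d dd0 dP]]].
    by exists [::] => //; exists 1.
  have e0 : 0 < Num.min d (r / 8) by rewrite lt_min dd0 divr_gt0.
  have [w [/andP[w0 wd] Fw]] := acc _ e0; rewrite lt_min in wd.
  have [wd1 wd2] := andP wd.
  exists (w :: s) => /=; first split; rewrite ?us ?sN ?andbT //.
    by apply/negP => /dP [+ _]; rewrite leNgt wd1.
  exists (cmod (w - p)) => // a; rewrite inE => /orP[/eqP ->|/dP[a1 a2]] //.
  by split => //; apply: le_trans (ltW wd1) a1.
have bound q N : cmod (q - p) < r / 8 -> cmod (F q) <= M0 * 2^-1 ^+ N.
  move=> qr; have [s [us sN] [d dd0 dP]] := many N.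
  have Fs a : a \in s -> cmod (a - p) <= 2 * r /\ F a = 0.
    by move=> /dP [_ [a1 a2]]; split => //; lra.
  have [g [[M gM] dg Fg]] := divide_zeros us FM dF' Fs.
  have prod_ge w : r <= cmod (w - p) <= 2 * r ->
      (r / 2) ^+ N <= cmod (\prod_(a <- s) (w - a)).
    move=> /andP[w1 _]; rewrite -sN.
    have : forall a, a \in s -> r / 2 <= cmod (w - a).
      move=> a /dP[_ [a1 _]]; have := cmodD (w - a) (a - p).
      by rewrite addrA subrK; lra.
    elim: s {us sN dP Fs dg Fg} => [_|a s IH sP]; first by rewrite big_nil cmod1.
    rewrite big_cons cmodM /= exprS; apply: ler_pM; rewrite ?exprn_ge0 //; try lra.
      by apply: sP; rewrite mem_head.
    by apply: IH => b bs; apply: sP; rewrite inE bs orbT.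
  have prod_le : cmod (\prod_(a <- s) (q - a)) <= (r / 4) ^+ N.
    rewrite -sN; have : forall a, a \in s -> cmod (q - a) <= r / 4.
      move=> a /dP[_ [a1 _]]; have := cmodD (q - p) (p - a).
      by rewrite addrA subrK (cmod_sub p a); lra.
    elim: s {us sN dP Fs dg Fg prod_ge} => [_|a s IH sP].
      by rewrite big_nil cmod1.
    rewrite big_cons cmodM /= exprS; apply: ler_pM; rewrite ?cmod_ge0 //.
      by apply: sP; rewrite mem_head.
    by apply: IH => b bs; apply: sP; rewrite inE bs orbT.
  have M00 : 0 <= M0.
    by apply: le_trans (FM p _); rewrite ?cmod_ge0 // subrr cmod0; lra.
  have [qs|qs] := boolP (q \in s).
    by rewrite (Fs _ qs).2 cmod0 mulr_ge0 // exprn_ge0 // invr_ge0.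
  have r2 : 0 < (r / 2) ^+ N by rewrite exprn_gt0 // divr_gt0.
  have gb w : r <= cmod (w - p) <= 2 * r -> cmod (g w) <= M0 / (r / 2) ^+ N.
    move=> wr; rewrite ler_pdivlMr //.
    apply: le_trans (_ : cmod (F w) <= _); last by apply: FM; case/andP: wr.
    by rewrite Fg cmodM ler_wpM2l ?cmod_ge0 ?prod_ge.
  have qr1 : cmod (q - p) < r by lra.
  have gq : cmod (g q) <= M0 / (r / 2) ^+ N.
    exact (maximum_principle_annulus r0 gM dg gb qr1 qs).
  rewrite Fg cmodM (_ : M0 * _ = M0 / (r / 2) ^+ N * (r / 4) ^+ N).
    by rewrite ler_pM ?cmod_ge0.
  rewrite -mulrA -exprVn -exprMn; congr (_ * _ ^+ _).
  by field; rewrite gt_eqF.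
exists (r / 8); first by rewrite divr_gt0.
move=> q qr; apply/eqP; rewrite -cmod_eq0 eq_le cmod_ge0 andbT leNgt.
apply/negP => Fq0; have : (1 : R) <= 2^-1; last by lra.
apply: (@ler_of_powers _ _ _ (M0 / cmod (F q))); first by rewrite invr_ge0.
move=> N; rewrite expr1n mulrAC ler_pdivlMr // mul1r; exact: bound.
Qed.

(** On an annulus around p the difference quotients of F based at points close to
    p are close to F'(p), since F is differentiable at p; by the maximum
    principle they are close to F'(p) inside as well. This replaces the
    continuity of F'. *)
Lemma strict_derivative F p d0 c : 0 < d0 -> 0 < c ->
  (forall w, cmod (w - p) < d0 -> derivable F w 1) ->
  exists2 r, 0 < r & forall z w, cmod (z - p) < r -> cmod (w - p) < r ->
    cmod (F z - F w - derive1 F p * (z - w)) <= c * cmod (z - w).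
Proof.
move=> d00 c0 dF.
have pp0 : cmod (p - p) < d0 by rewrite subrr cmod0.
have c4 : 0 < c / 4 by rewrite divr_gt0.
set l := derive1 F p.
have [d1 d10 [M0 M0P]] := derivable_near_bounded (dF p pp0).
have [d2 d20 d2P] := derivable_approx (dF p pp0) c4.
pose m := Num.min d0 (Num.min d1 d2); pose r := m / 4.
have m0 : 0 < m by rewrite !lt_min d00 d10.
have r0 : 0 < r by rewrite divr_gt0.
have [rd0 rd1 rd2] : [/\ 2 * r < d0, 2 * r < d1 & 2 * r < d2].
  have : 2 * r < m by rewrite /r; lra.
  by rewrite !lt_min => /andP[-> /andP[-> ->]].
exists (r / 2); first by rewrite divr_gt0.
move=> z w zr wr.
have wd0 : cmod (w - p) < d0 by lra.
have [M1 M1P] : exists M1, forall v, cmod (v - p) <= 2 * r ->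
    cmod (slope F w v) <= M1.
  apply: (@slope_bounded _ F w M0 [set v | cmod (v - p) <= 2 * r] (dF w wd0)).
  by move=> v /= vr; apply: M0P; exact: le_lt_trans vr rd1.
have [->|zw] := eqVneq z w; first by rewrite !subrr mulr0 subrr cmod0 mulr0.
have zw0 : z - w != 0 by rewrite subr_eq0.
pose q v := slope F w v - l.
have qM v : cmod (v - p) <= 2 * r -> cmod (q v) <= M1 + cmod l.
  by move=> /M1P H; apply: le_trans (cmodB _ _) _; rewrite lerD2r.
have dq v : cmod (v - p) <= 2 * r -> v \notin [:: w] -> derivable q v 1.
  rewrite inE => vr vw; have vd0 := le_lt_trans vr rd0.
  exact (derivableB (derivable_slope vw (dF v vd0)) (derivable_cst l v 1)).
have qc v : r <= cmod (v - p) <= 2 * r -> cmod (q v) <= c.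
  move=> /andP[v1 v2].
  have vw : 2^-1 * cmod (v - p) <= cmod (v - w).
    by have := cmodD (v - w) (w - p); rewrite addrA subrK; lra.
  have vw0 : v - w != 0 by rewrite -cmod_gt0; lra.
  have -> : q v = ((F v - F p - l * (v - p)) - (F w - F p - l * (w - p))) / (v - w).
    by rewrite /q /slope; field.
  rewrite cmodM cmodV ler_pdivrMr ?cmod_gt0 //.
  apply: le_trans (cmodB _ _) _.
  have a1 := d2P v (le_lt_trans v2 rd2).
  have wd2 : cmod (w - p) < d2 by lra.
  have a2 := d2P w wd2.
  apply: le_trans (lerD a1 a2) _; rewrite -mulrDr -mulrA ler_pM2l //.
  by lra.
have zr1 : cmod (z - p) < r by lra.
have zE : z \notin [:: w] by rewrite inE.
have H := maximum_principle_annulus r0 qM dq qc zr1 zE.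
have -> : F z - F w - l * (z - w) = q z * (z - w) by rewrite /q /slope; field.
by rewrite cmodM ler_wpM2r ?cmod_ge0.
Qed.

(** By strict_derivative F is bi-Lipschitz near p. It is onto a disc around F p:
    a minimum z of |F z - u| on a closed disc around p is an interior point, and
    if it were not a zero, moving z in the direction (u - F z) / F'(p) would
    lower it. *)
Lemma local_inverse F p d0 r0 : 0 < d0 -> 0 < r0 ->
  (forall w, cmod (w - p) < d0 -> derivable F w 1) -> derive1 F p != 0 ->
  exists r rho K (G : C -> C), [/\ 0 < r <= r0, 0 < rho,
    forall u, cmod (u - F p) < rho -> cmod (G u - p) < r /\ F (G u) = u,
    forall w, cmod (w - p) < r -> cmod (F w - F p) < rho -> G (F w) = w &
    forall u v, cmod (u - F p) < rho -> cmod (v - F p) < rho ->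
      cmod (G u - G v) <= K * cmod (u - v)].
Proof.
move=> d00 r00 dF l0; set l := derive1 F p in l0 *.
have cl0 : 0 < cmod l by rewrite cmod_gt0.
have cl2 : 0 < cmod l / 2 by rewrite divr_gt0.
have [r1 r10 r1P] := strict_derivative d00 cl2 dF; rewrite -/l in r1P.
pose r := Num.min (Num.min r0 r1) d0 / 2.
have m0 : 0 < Num.min (Num.min r0 r1) d0 by rewrite !lt_min r00 r10.
have rp : 0 < r by rewrite divr_gt0.
have [rr0 rr1 rd0] : [/\ r < r0, r < r1 & r < d0].
  have : r < Num.min (Num.min r0 r1) d0 by rewrite /r; lra.
  by rewrite !lt_min => /andP[/andP[-> ->] ->].
have lip z w : cmod (z - p) <= r -> cmod (w - p) <= r ->
    cmod l / 2 * cmod (z - w) <= cmod (F z - F w).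
  move=> zr wr; have := r1P z w (le_lt_trans zr rr1) (le_lt_trans wr rr1).
  have := cmod_triangle (l * (z - w)) (F z - F w).
  by rewrite (cmod_sub (l * _)) cmodM; lra.
pose rho := cmod l * r / 4.
have rho0 : 0 < rho by rewrite divr_gt0 // mulr_gt0.
have pr : cmod (p - p) <= r by rewrite subrr cmod0 ltW.
have surj u : cmod (u - F p) < rho -> exists z, cmod (z - p) < r /\ F z = u.
  move=> urho; pose D := [set z : C | cmod (z - p) <= r].
  have Dp : D p by [].
  have cD : compact D.
    have -> : D = (fun z => z + p) @` [set z | cmod z <= r].
      apply/seteqP; split=> [z zr|_ [z zr <-]]; last by rewrite /D /= addrK.
      by exists (z - p) => //; rewrite subrK.
    apply: continuous_compact; last exact: compact_cball.
    apply: continuous_subspaceT => z U /cnbhsP[e e0 eU]; apply/cnbhsP.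
    exists e => // w wz; apply: eU.
    by rewrite (_ : w + p - (z + p) = w - z) //; ring.
  have cF : {within D, continuous (fun z => cmod (F z - u))}.
    apply: continuous_in_subspaceT => z /set_mem Dz.
    have /derivable1_diffP/differentiable_continuous cFz := dF z (le_lt_trans Dz rd0).
    apply: (@continuous_comp _ _ _ (fun w => F w - u) (@cmod R)); last first.
      exact: cmod_continuous.
    exact: (@cvgB _ _ _ _ _ F (cst u) _ _ cFz (cvg_cst u)).
  have [z zD zmin] := @compact_EVT_min _ _ _ D (ex_intro _ p Dp) cD cF.
  have {}zD : D z := set_mem zD.
  exists z; have zp := zmin p (mem_set Dp).
  have zr : cmod (z - p) < r.
    rewrite lt_neqAle zD andbT; apply/eqP => zr.
    have := lip z p zD pr; have := cmod_triangle (F z - F p) (u - F p).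
    rewrite zr (_ : F z - F p - (u - F p) = F z - u); last by ring.
    by rewrite (cmod_sub (F p)) in zp; rewrite /rho in urho; lra.
  split=> //; apply/eqP; rewrite -subr_eq0 -cmod_eq0 eq_le cmod_ge0 andbT leNgt.
  apply/negP => Fu; set A := cmod (F z - u) in Fu.
  (* The largest step t <= 1 that keeps z' in the disc. *)
  pose t := Num.min 1 ((r - cmod (z - p)) * cmod l / A).
  have t0 : 0 < t by rewrite lt_min ltr01 divr_gt0 // mulr_gt0 // subr_gt0.
  have t1 : t <= 1 by rewrite ge_min lexx.
  have tA : t * A / cmod l <= r - cmod (z - p).
    by rewrite ler_pdivrMr // -ler_pdivlMr // ge_min lexx orbT.
  pose z' := z + rc t * ((u - F z) / l).
  have z'z : cmod (z' - z) = t * A / cmod l.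
    rewrite /z' addrC addKr !cmodM cmodV cmod_rc gtr0_norm // mulrA.
    by rewrite (cmod_sub u).
  have z'r : cmod (z' - p) <= r.
    have := cmodD (z' - z) (z - p); rewrite addrA subrK z'z; lra.
  have := zmin z' (mem_set z'r); rewrite -/A leNgt => /negP; apply.
  have := r1P z' z (le_lt_trans z'r rr1) (lt_trans zr rr1).
  rewrite z'z (_ : cmod l / 2 * (t * A / cmod l) = t * A / 2); last first.
    by field; rewrite gt_eqF.
  have -> : l * (z' - z) = rc t * (u - F z) by rewrite /z'; field.
  have := cmod_triangle (F z' - u) (rc (1 - t) * (F z - u)).
  rewrite cmodM cmod_rc ger0_norm; last by rewrite subr_ge0.
  rewrite (_ : F z' - u - _ = F z' - F z - rc t * (u - F z)); last first.
    by rewrite rmorphB rmorph1; ring.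
  rewrite -/A; have : 0 < t * A by rewrite mulr_gt0.
  by rewrite mulrBl mul1r; lra.
pose P u z := cmod (z - p) < r /\ F z = u.
have ex u : exists z, cmod (u - F p) < rho -> P u z.
  have [ur|ur] := pselect (cmod (u - F p) < rho); last by exists p => /ur.
  by have [z zP] := surj u ur; exists z.
have [G GP] := choice ex.
exists r, rho, (2 / cmod l), G; split => //.
- by rewrite rp ltW.
- move=> w wr Fwr; have [Gr FG] := GP _ Fwr.
  have := lip (G (F w)) w (ltW Gr) (ltW wr); rewrite FG subrr cmod0.
  rewrite pmulr_rle0 // => H; apply/eqP; rewrite -subr_eq0 -cmod_eq0.
  by rewrite eq_le H cmod_ge0.
- move=> u v ur vr; have [Gu Fu] := GP _ ur; have [Gv Fv] := GP _ vr.
  have := lip _ _ (ltW Gu) (ltW Gv); rewrite Fu Fv.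
  rewrite (_ : 2 / cmod l = (cmod l / 2)^-1); last by rewrite invf_div.
  by rewrite ler_pdivlMl.
Qed.

End local_theory.

(** * Holomorphic maps between compact Riemann surfaces *)

Section surface_topology.
Context {R : realType}.
Local Notation C := (Cplx R).

Lemma connected_induction (X : topologicalType) (P : set X) : connected [set: X] ->
  (forall p, P p -> nbhs p P) ->
  (forall p, (forall N, nbhs p N -> exists2 q, N q & P q) -> P p) ->
  forall x y, P x -> P y.
Proof.
move=> cX oP cP x y Px; suff -> : P = setT by [].
apply: cX; first by exists x.
  by exists P; rewrite ?setTI // openE => p /oP.
exists P; rewrite ?setTI // => p clp; apply: cP => N /clp[q [Pq Nq]].
by exists q.
Qed.

Section charts.
Variable X : riemannSurface R.
Implicit Types (c d : chart R X) (p q x u v : X) (N A : set X).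

Lemma chart_dom_nbhs c p : chart_dom c p -> nbhs p (chart_dom c).
Proof. by move=> cp; apply: open_nbhs_nbhs; split => //; exact: chart_dom_open. Qed.

Lemma chart_inj c p q : chart_dom c p -> chart_dom c q -> c p = c q -> p = q.
Proof.
move=> cp cq E; rewrite -(chart_funK (mem_set cp)) E.
exact: chart_funK (mem_set cq).
Qed.
(** Near c p the inverse chart is a genuine two-sided inverse, with values in any
    prescribed neighborhood of p. *)
Lemma chart_disc c p N : chart_dom c p -> nbhs p N ->
  exists2 e : R, 0 < e & forall w, cmod (w - c p) < e ->
    [/\ chart_dom c (chart_inv c w), N (chart_inv c w) & c (chart_inv c w) = w].
Proof.
move=> cp Np; have cpim : (c @` chart_dom c) (c p) by exists p.
have im : nbhs (c p) (c @` chart_dom c).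
  by apply: open_nbhs_nbhs; split => //; exact: chart_img_open.
have pull : nbhs (c p) (chart_inv c @^-1` (N `&` chart_dom c)).
  apply: (chart_inv_continuous (mem_set cpim)).
  by rewrite (chart_funK (mem_set cp)); apply: filterI => //; exact: chart_dom_nbhs.
have [e e0 eP] := (cnbhsP _ _).1 (filterI im pull).
exists e => // w /eP[[q cq <-] [Nw cw]]; split => //.
by rewrite (chart_funK (mem_set cq)).
Qed.

Lemma chart_disc_nbhs c p (e : R) : chart_dom c p -> 0 < e ->
  nbhs p [set x | chart_dom c x /\ cmod (c x - c p) < e].
Proof.
move=> cp e0; apply: filterI; first exact: chart_dom_nbhs.
have ball_e : nbhs (c p) [set w | cmod (w - c p) < e] by apply/cnbhsP; exists e.
exact: (chart_continuous (mem_set cp) ball_e).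
Qed.

Lemma surface_closed1 p : closed [set p].
Proof.
exact: accessible_closed_set1 (hausdorff_accessible (@rs_hausdorff _ X)) p.
Qed.

End charts.

Section holomorphic.
Variables (X Y : riemannSurface R) (f : holomorphicMap X Y).

Lemma local_coordinates (p : X) (N : set X) : nbhs p N -> exists c d (e : R),
  [/\ rs_atlas c, rs_atlas d, chart_dom c p /\ chart_dom d (f p), 0 < e &
    forall w, cmod (w - c p) < e ->
    [/\ chart_dom c (chart_inv c w), chart_dom d (f (chart_inv c w)),
        N (chart_inv c w), c (chart_inv c w) = w &
        derivable (d \o f \o chart_inv c) w 1]].
Proof.
move=> Np; have [c ac cp] := rs_cover p; have [d ad dp] := rs_cover (f p).
have Np' : nbhs p (N `&` f @^-1` chart_dom d).
  by apply: filterI => //; apply: holo_continuous; exact: chart_dom_nbhs.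
have [e e0 eP] := chart_disc cp Np'.
exists c, d, e; split => // w /eP[cw [Nw dw] cK]; split => //.
by have := holo_derivable ac ad cw dw; rewrite cK.
Qed.

(** The identity theorem: at an accumulation point of the fiber the map is locally
    constant, so the interior W of the fiber is closed as well as open. As f is
    not constant, W is empty, and so is the set of accumulation points. *)
Lemma fiber_isolated (s : Y) (p : X) :
  exists2 N : set X, nbhs p N & forall x, N x -> x <> p -> f x <> s.
Proof.
pose acc (q : X) := forall N : set X, nbhs q N ->
  exists x : X, [/\ N x, x <> q & f x = s].
pose W : set X := [set q : X | nbhs q [set x | f x = s]].
have accW q : acc q -> W q.
  move=> aq; have fq : f q = s.
    apply: contrapT => fqs.
    have : nbhs (f q) (~` [set s]).
      by apply: open_nbhs_nbhs; split => //; exact/closed_openC/surface_closed1.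
    by move=> /(@holo_continuous _ _ _ f q) /aq[x [] /=].
  have [c [d [e [ac ad [cq dq] e0 eP]]]] := local_coordinates (@filterT _ (nbhs q) _).
  pose F (w : C) : C := (d \o f \o chart_inv c) w - d s.
  have dF w : cmod (w - c q) < e -> derivable F w 1.
    move=> /eP[_ _ _ _ dw].
    exact (derivableB dw (derivable_cst (d s : C) w 1)).
  have Facc (r : R) : 0 < r -> exists w, 0 < cmod (w - c q) < r /\ F w = 0.
    move=> r0; have [x [[cx xr] xq fx]] := aq _ (chart_disc_nbhs cq r0).
    exists (c x); rewrite xr andbT cmod_gt0 subr_eq0; split.
      by apply/eqP => /(chart_inj cx cq).
    by rewrite /F /= (chart_funK (mem_set cx)) fx subrr.
  have [r r0 rP] := zero_near_limit_of_zeros e0 dF Facc.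
  have m0 : 0 < Num.min e r by rewrite lt_min e0.
  apply: filterS (chart_disc_nbhs cq m0) => x [cx]; rewrite lt_min => /andP[xe xr] /=.
  have [_ dx _ _ _] := eP _ xe; rewrite (chart_funK (mem_set cx)) in dx.
  apply: chart_inj dx _ _; first by rewrite -fq.
  have := rP _ xr; rewrite /F /= (chart_funK (mem_set cx)).
  by move=> /subr0_eq.
have noW q : ~ W q.
  move=> Wq; have [x [y xy]] := holo_nonconstant f; apply: xy.
  have all z : W z.
    apply: connected_induction Wq; first exact: rs_connected.
      move=> v; rewrite /W /= nbhsE => -[U [oU Uv] UW].
      by exists U => // u Uu; rewrite /W /= nbhsE; exists U.
    move=> v vW; have [//|nWv] := pselect (W v); apply: accW => N /vW[u Nu Wu].
    exists u; split => //; first by move=> uv; rewrite uv in Wu.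
    exact: nbhs_singleton Wu.
  by rewrite (nbhs_singleton (all x)) (nbhs_singleton (all y)).
apply: contrapT => nN; apply: (noW p); apply: accW => N Np.
apply: contrapT => nx; apply: nN; exists N => // x Nx xp fx.
by apply: nx; exists x.
Qed.

Lemma fibers_isolated (S : set Y) (p : X) : finite_set S ->
  exists2 N : set X, nbhs p N & forall x, N x -> x <> p -> ~ S (f x).
Proof.
move=> /finite_seqP[s ->]; elim: s => [|a s [N Np NP]].
  by exists setT; [exact: filterT|move=> x _ _].
have [M Mp MP] := fiber_isolated a p.
exists (N `&` M); first exact: filterI.
move=> x [Nx Mx] xp; rewrite /= inE => /orP[/eqP|]; first exact: MP.
exact: NP.
Qed.

Definition section_on (V : set Y) (sigma : Y -> X) :=
  forall y, V y -> f (sigma y) = y /\ {for y, continuous sigma}.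

Lemma local_section (p : X) : unramified_at f p ->
  exists U V sigma, [/\ nbhs p U, nbhs (f p) V, section_on V sigma &
    forall x, U x -> V (f x) -> sigma (f x) = x].
Proof.
move=> up.
have [c [d [e [ac ad [cp dp] e0 eP]]]] := local_coordinates (@filterT _ (nbhs p) _).
pose F : C -> C := d \o f \o chart_inv c.
have dF w : cmod (w - c p) < e -> derivable F w 1 by move=> /eP[].
have [r [rho [K [G [/andP[r0 re] rho0 GP GK GL]]]]] :=
  local_inverse e0 e0 dF (up c d ac ad cp dp).
have Fcp : F (c p) = d (f p) by rewrite /F /= (chart_funK (mem_set cp)).
rewrite Fcp in GP GK GL.
exists [set x | chart_dom c x /\ cmod (c x - c p) < r].
exists [set y | chart_dom d y /\ cmod (d y - d (f p)) < rho].
exists (fun y => chart_inv c (G (d y))); split.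
- exact: chart_disc_nbhs.
- exact: chart_disc_nbhs.
- move=> y [dy yr]; have [Gr FG] := GP _ yr.
  have [cG dG _ cK _] := eP _ (lt_le_trans Gr re); split.
    exact: chart_inj dG dy FG.
  have cim : (c @` chart_dom c) (G (d y)) by exists (chart_inv c (G (d y))).
  move=> M /(chart_inv_continuous (mem_set cim)) /cnbhsP[e1 e10 e1P].
  pose K1 := `|K| + 1; have K10 : 0 < K1 by rewrite ltr_wpDl.
  have V1 : nbhs y [set y' | chart_dom d y' /\ cmod (d y' - d (f p)) < rho].
    have rr : 0 < rho - cmod (d y - d (f p)) by rewrite subr_gt0.
    apply: filterS (chart_disc_nbhs dy rr) => z [dz zr]; split => //.
    by have := cmodD (d z - d y) (d y - d (f p)); rewrite addrA subrK; lra.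
  have e1K : 0 < e1 / K1 by rewrite divr_gt0.
  apply: filterS (filterI V1 (chart_disc_nbhs dy e1K)) => z [[dz zr] [_ zy]] /=.
  apply: e1P; apply: le_lt_trans (GL _ _ zr yr) _.
  rewrite ltr_pdivlMr // in zy; apply: le_lt_trans zy.
  rewrite mulrC ler_wpM2l ?cmod_ge0 //; apply: le_trans (ler_norm K) _.
  by rewrite lerDl.
- move=> x [cx xr] [dx fxr]; rewrite -[RHS](chart_funK (mem_set cx)).
  have FE : F (c x) = d (f x) by rewrite /F /= (chart_funK (mem_set cx)).
  by rewrite -FE GK // FE.
Qed.

Variable S : set Y.
Hypothesis uS : unramified_outside f S.

(** Only finitely many local sections are involved, by compactness of X: over a
    small neighborhood V of y, every point of the preimage lies in the domain of
    one of the local sections at points of the fiber of y, since away from these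
    domains f avoids a neighborhood of y. Shrinking neighborhoods V are handled
    by the filter of small neighborhoods of y. *)
Lemma evenly_covered (y : Y) : ~ S y -> exists2 V, nbhs y V &
  forall x, V (f x) -> exists2 sigma, section_on V sigma & sigma (f x) = x.
Proof.
move=> Sy.
pose P (V : set Y) x := V (f x) -> exists2 sigma, section_on V sigma & sigma (f x) = x.
have sub V W sigma : V `<=` W -> section_on W sigma -> section_on V sigma.
  by move=> VW sW z /VW /sW.
have near_small V0 : nbhs y V0 ->
    \forall V \near powerset_filter_from (nbhs y), V `<=` V0.
  by move=> yV0; exact: small_set_sub.
have : \forall V \near powerset_filter_from (nbhs y), [set: X] `<=` P V.
  have /compact_near_coveringP := @rs_compact _ X; apply => x _.
  have [fx|fx] := pselect (f x = y).
    have [|U [V [sigma [Ux Vfx sV sK]]]] := @local_section x.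
      by apply: uS; rewrite fx.
    rewrite fx in Vfx.
    exists (U, [set W | W `<=` V]); first by split => //; exact: near_small.
    move=> [x' W] [/= Ux' WV] Wf; exists sigma; first exact: sub sV.
    by apply: sK => //; exact: WV.
  have := @rs_hausdorff _ Y; rewrite open_hausdorff.
  have /eqP fxy := fx; move=> /(_ _ _ fxy)[[A B] /= [xA yB] [oA oB /eqP AB]].
  rewrite !inE in xA yB.
  exists (f @^-1` A, [set W | W `<=` B]); first split.
  - by apply: holo_continuous; exact: open_nbhs_nbhs.
  - by apply: near_small; exact: open_nbhs_nbhs.
  move=> [x' W] [/= Ax' WB] /WB Bx'.
  by have : (A `&` B) (f x') by []; rewrite AB.
move=> cov; have [V [yV VP]] :=
  filter_ex (filterI (near_small_set (nbhs_pfilter y)) cov).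
by exists V => // x; exact: VP.
Qed.

(** Induction on intervals: over a short interval the path stays in an evenly
    covered set, where it is lifted by a section. *)
Lemma path_lifting (gamma : R -> Y) (x0 : X) : continuous gamma ->
  (forall t, ~ S (gamma t)) -> f x0 = gamma 0 ->
  exists h : R -> X, [/\ continuous h, h 0 = x0 &
    forall t, 0 <= t <= 1 -> f (h t) = gamma t].
Proof.
move=> cg Sg f0.
pose P (s _ k : R) := forall x, f x = gamma s -> exists h : R -> X,
  [/\ continuous h, h s = x & forall t, s <= t <= s + k -> f (h t) = gamma t].
suff H : P 0 0 1.
  have [h [ch h0 hP]] := H x0 f0; exists h; split => // t t01.
  by apply: hP; rewrite add0r.
apply: square_induction => //.
  move=> s y k k0 P1 P2 _ _ x fx; have [h1 [c1 h1s h1P]] := P1 x fx.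
  have [|h2 [c2 h2s h2P]] := P2 (h1 (s + k)).
    by apply: h1P; rewrite lexx lerDl ltW.
  exists (fun t => if t <= s + k then h1 t else h2 t); split.
  - apply: if_continuous => //; first by move=> t; exact: cvg_id.
    by move=> t ->.
  - by rewrite lerDl ltW.
  - move=> t /andP[t1 t2]; case: ifP => [tk|/negbT]; first by apply: h1P; rewrite t1.
    rewrite -ltNge => tk; apply: h2P; rewrite (ltW tk) /=; lra.
move=> a b _ _; have [V Vy VP] := evenly_covered (Sg a).
have /nbhs_ballP[d /= d0 dP] := cg a _ Vy.
exists d => // s y k /andP[k0 kd] /andP[sa ask] _ _ _ _ _ x fx.
have inV u : s <= u <= s + k -> V (gamma u).
  move=> /andP[u1 u2]; apply: dP; rewrite -ball_normE /= ltr_norml.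
  by apply/andP; split; lra.
have Vs : V (gamma s) by apply: inV; rewrite lexx lerDl ltW.
rewrite -fx in Vs; have [sigma sV sx] := VP x Vs.
(* Outside [s, s + k] the path may leave V, so its parameter is clamped. *)
pose cl (u : R) := Num.max s (Num.min u (s + k)).
have cl_in u : s <= cl u <= s + k.
  rewrite /cl le_max lexx /= ge_max lerDl (ltW k0) /=.
  by rewrite ge_min lexx orbT.
have cl_id u : s <= u <= s + k -> cl u = u.
  by move=> /andP[u1 u2]; rewrite /cl (min_idPl u2) (max_idPr u1).
have ccl : continuous cl.
  move=> u; apply: (@continuous_max R R (cst s) (Num.min^~ (s + k)) u).
    exact: cst_continuous.
  apply: (@continuous_min R R id (cst (s + k)) u); first exact: cvg_id.
  exact: cst_continuous.
exists (fun u => sigma (gamma (cl u))); split.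
- move=> u; apply: (@continuous_comp _ _ _ (fun u => gamma (cl u)) sigma).
    exact: (@cont_comp _ _ _ gamma cl cg ccl u).
  exact: (sV _ (inV _ (cl_in u))).2.
- by rewrite cl_id ?lexx ?lerDl ?(ltW k0) // -fx.
- by move=> t tk; rewrite cl_id //; exact: (sV _ (inV _ tk)).1.
Qed.

End holomorphic.

End surface_topology.

(** * Complements of discrete sets are path connected *)

Section complement_path_connected.
Context {R : realType}.
Local Notation C := (Cplx R).

Definition avoiding_path (X : topologicalType) (A : set X) (u v : X) :=
  exists gamma : R -> X,
    [/\ continuous gamma, gamma 0 = u, gamma 1 = v & forall t, ~ A (gamma t)].

Section generalities.
Variables (X : topologicalType) (A : set X).

Lemma avoiding_path_trans v u w :
  avoiding_path A u v -> avoiding_path A v w -> avoiding_path A u w.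
Proof.
move=> [g [cg g0 g1 gA]] [k [ck k0 k1 kA]].
exists (fun t => if t <= 2^-1 then g (2 * t + 0) else k (2 * t - 1)); split.
- apply: if_continuous => [t|||t ->]; first exact: cvg_id.
  + apply: (@cont_comp _ _ _ g); first exact: cg.
    by apply: cont_affine => t; exact: cvg_id.
  + apply: (@cont_comp _ _ _ k); first exact: ck.
    by apply: cont_affine => t; exact: cvg_id.
  + by rewrite divff ?pnatr_eq0 // addr0 subrr g1 k0.
- by rewrite ifT ?mulr0 ?addr0 // invr_ge0.
- rewrite ifF; first by rewrite mulr1 (_ : 2 - 1 = 1) //; ring.
  by apply/negbTE; rewrite -ltNge; lra.
- by move=> t; case: ifP.
Qed.

End generalities.

Section surface.
Variables (X : riemannSurface R) (A : set X).

Lemma segment_continuous (g : R -> R) (w v : C) : continuous g ->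
  continuous (fun t => w + rc (g t) * v).
Proof.
move=> cg t U /cnbhsP[e e0 eU].
have K0 : 0 < cmod v + 1 by rewrite ltr_wpDl ?cmod_ge0.
have eK : 0 < e / (cmod v + 1) by rewrite divr_gt0.
have gb : nbhs t [set s | ball (g t) (e / (cmod v + 1)) (g s)].
  by apply: (cg t); exact: nbhsx_ballx.
suff : nbhs t [set s | U (w + rc (g s) * v)] by [].
apply: filterS gb => s /=; rewrite -ball_normE /= => gs; apply: eU.
rewrite (_ : _ - _ = rc (g s - g t) * v); last by rewrite rmorphB; ring.
rewrite cmodM cmod_rc distrC; rewrite ltr_pdivlMr // in gs.
apply: le_lt_trans gs; rewrite ler_wpM2l //; lra.
Qed.

Lemma segment_in_disc (o w1 w2 : C) (e t : R) : 0 <= t <= 1 ->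
  cmod (w1 - o) < e -> cmod (w2 - o) < e ->
  cmod (w1 + rc t * (w2 - w1) - o) < e.
Proof.
move=> /andP[t0 t1] w1e w2e.
have -> : w1 + rc t * (w2 - w1) - o = rc (1 - t) * (w1 - o) + rc t * (w2 - o).
  by rewrite rmorphB rmorph1; ring.
apply: le_lt_trans (cmodD _ _) _; rewrite !cmodM !cmod_rc.
rewrite (ger0_norm t0) ger0_norm ?subr_ge0 //.
have [t10|t1'] := eqVneq t 1; first by rewrite t10 subrr mul0r add0r mul1r.
have t1s : 0 < 1 - t by rewrite subr_gt0 lt_neqAle t1'.
apply: lt_le_trans (_ : (1 - t) * e + t * e <= _).
  by apply: ltr_leD; rewrite ?ltr_pM2l // ler_wpM2l // ltW.
by rewrite -mulrDl subrK mul1r.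
Qed.

Lemma avoiding_segment (c : chart R X) (p : X) (e : R) (w1 w2 : C) :
  (forall w, cmod (w - c p) < e ->
     chart_dom c (chart_inv c w) /\ c (chart_inv c w) = w) ->
  cmod (w1 - c p) < e -> cmod (w2 - c p) < e ->
  (forall t : R, 0 <= t <= 1 -> ~ A (chart_inv c (w1 + rc t * (w2 - w1)))) ->
  avoiding_path A (chart_inv c w1) (chart_inv c w2).
Proof.
move=> eP w1e w2e segA.
have cl t := ofI_itv (toI (t : R)).
exists (fun t => chart_inv c (w1 + rc (clamp t) * (w2 - w1))); split.
- move=> t; apply: (@continuous_comp R C X
    (fun t => w1 + rc (clamp t) * (w2 - w1)) (chart_inv c)).
    exact: (segment_continuous (@clamp_continuous R)).
  apply: chart_inv_continuous; apply/mem_set.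
  have [dw cw] := eP _ (segment_in_disc (cl t) w1e w2e).
  by exists (chart_inv c (w1 + rc (clamp t) * (w2 - w1))).
- by rewrite clamp_le0 // rmorph0 mul0r addr0.
- by rewrite clamp_ge1 // rmorph1 mul1r addrC subrK.
- by move=> t; apply: segA; exact: cl.
Qed.

Hypothesis isoA : forall p : X,
  exists2 N : set X, nbhs p N & forall x, N x -> x <> p -> ~ A x.

(** In a disc where only the centre o may belong to A, two points a and b are
    joined by a segment, unless it runs through o; the detour through
    o + i (a - o) then avoids o. *)
Lemma locally_avoiding (p : X) : exists2 N : set X, nbhs p N &
  forall u v, N u -> N v -> ~ A u -> ~ A v -> avoiding_path A u v.
Proof.
have [N0 N0p N0A] := isoA p; have [c _ cp] := rs_cover p.
have [e e0 eP] := chart_disc cp N0p.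
have eP' w : cmod (w - c p) < e ->
    chart_dom c (chart_inv c w) /\ c (chart_inv c w) = w.
  by move=> /eP[].
exists [set x | chart_dom c x /\ cmod (c x - c p) < e]; first exact: chart_disc_nbhs.
move=> u v [cu ue] [cv ve] Au Av.
pose o := c p; pose a := c u; pose b := c v.
rewrite -(chart_funK (mem_set cu)) -(chart_funK (mem_set cv)) -/a -/b.
have onlyp w : cmod (w - o) < e -> w <> o -> ~ A (chart_inv c w).
  move=> we wo; have [cw Nw cK] := eP _ we; apply: N0A => // E.
  by apply: wo; rewrite -cK E.
have [avoid|] := pselect (forall t : R, 0 <= t <= 1 ->
    ~ A (chart_inv c (a + rc t * (b - a)))).
  exact: avoiding_segment eP' ue ve avoid.
move=> /existsNP[t /not_implyP[t01 /contrapT At]].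
have Et : a + rc t * (b - a) = o.
  by apply: contrapT => /(onlyp _ (segment_in_disc t01 ue ve)).
have Ap : A p by move: At; rewrite Et /o (chart_funK (mem_set cp)).
have ao : a - o != 0.
  rewrite subr_eq0; apply/eqP => /(chart_inj cu cp) up.
  by rewrite up in Au.
have bo : b - o != 0.
  rewrite subr_eq0; apply/eqP => /(chart_inj cv cp) vp.
  by rewrite vp in Av.
pose m := o + ci * (a - o).
have me : cmod (m - o) < e by rewrite /m addrC addKr cmodM cmod_ci mul1r.
have nz (x y : R) : rc x + ci * rc y = 0 -> x = 0 /\ y = 0.
  move=> H; have := congr1 (@complex.Re R) H; have := congr1 (@complex.Im R) H.
  by rewrite !ReImE /= => Hy Hx; split; lra.
apply: (@avoiding_path_trans _ _ (chart_inv c m)).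
  apply: (avoiding_segment eP' ue me) => s s01.
  apply: onlyp; first exact: (segment_in_disc s01 ue me).
  move=> E; have : (a - o) * (rc (1 - s) + ci * rc s) = 0.
    have -> : (a - o) * (rc (1 - s) + ci * rc s) = a + rc s * (m - a) - o.
      by rewrite /m rmorphB rmorph1; ring.
    by rewrite E subrr.
  by move=> /eqP; rewrite mulf_eq0 (negbTE ao) => /eqP/nz[]; lra.
apply: (avoiding_segment eP' me ve) => s s01.
apply: onlyp; first exact: (segment_in_disc s01 me ve).
move=> E; have : (a - o) * (rc (- (s * (1 - t))) + ci * rc ((1 - s) * t)) = 0.
  have -> : (a - o) * (rc (- (s * (1 - t))) + ci * rc ((1 - s) * t)) =
      rc t * (m + rc s * (b - m) - o) - rc s * (a + rc t * (b - a) - o).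
    by rewrite /m rmorphN !rmorphM !rmorphB !rmorph1; ring.
  by rewrite E Et !subrr !mulr0 subrr.
move=> /eqP; rewrite mulf_eq0 (negbTE ao) => /eqP/nz[/eqP + /eqP].
rewrite oppr_eq0 !mulf_eq0 !subr_eq0 => /orP[/eqP s0|/eqP t1].
  move=> /orP[/eqP s1|/eqP t0]; first by move: s1; rewrite s0; lra.
  by move: Et; rewrite t0 rmorph0 mul0r addr0 => /eqP; rewrite -subr_eq0 (negbTE ao).
have := Et; rewrite -t1 rmorph1 mul1r addrC subrK => bE _.
by move: bo; rewrite bE subrr eqxx.
Qed.

Lemma isolated_dense (p : X) (N : set X) : nbhs p N -> exists2 u, N u & ~ A u.
Proof.
move=> Np; have [N0 N0p N0A] := isoA p; have [c _ cp] := rs_cover p.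
have [e e0 eP] := chart_disc cp (filterI Np N0p).
pose w := c p + rc (e / 2).
have we : cmod (w - c p) < e.
  by rewrite /w addrC addKr cmod_rc gtr0_norm ?divr_gt0 //; lra.
have [cw [Nw N0w] cK] := eP w we.
exists (chart_inv c w) => //; apply: N0A => // E.
have : w - c p = 0 by rewrite -cK E subrr.
rewrite /w addrC addKr => /eqP.
by rewrite (negbTE (rc_neq0 _)) // gt_eqF // divr_gt0.
Qed.

(** The points around which A is avoided by paths from u form a set that is open
    by definition, and closed because any neighborhood of a point contains points
    off A. *)
Lemma complement_path_connected (u v : X) : ~ A u -> ~ A v -> avoiding_path A u v.
Proof.
move=> Au Av.
pose P : set X := [set p : X | exists2 N : set X, nbhs p N &
  forall q, N q -> ~ A q -> avoiding_path A u q].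
have Pu : P u.
  have [N Nu NP] := locally_avoiding u; exists N => // q Nq Aq.
  by apply: NP => //; exact: nbhs_singleton Nu.
have : P v.
  apply: connected_induction Pu; first exact: rs_connected.
    move=> p [N Np NP]; move: Np; rewrite nbhsE => -[U [oU Up] UN].
    exists U => // q Uq; exists U; first exact: open_nbhs_nbhs.
    by move=> z /UN; exact: NP.
  move=> p clp; have [N Np NP] := locally_avoiding p; exists N => // q Nq Aq.
  move: (Np); rewrite nbhsE => -[U [oU Up] UN].
  have [z Uz [M Mz MP]] := clp U (open_nbhs_nbhs (conj oU Up)).
  have [x [Ux Mx] Ax] := isolated_dense (filterI (open_nbhs_nbhs (conj oU Uz)) Mz).
  apply: (@avoiding_path_trans _ _ x); first exact: MP.
  by apply: NP => //; exact: UN.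
by move=> [N Nv]; apply => //; exact: nbhs_singleton Nv.
Qed.

End surface.

End complement_path_connected.

(** * The monodromy action *)

Section monodromy_action.
Context {R : realType}.
Local Notation I := (unit_interval R).

Lemma path_in_complement (X : topologicalType) (S : set X) (a b : ~` S)
    (gamma : R -> X) : continuous gamma -> gamma 0 = val a -> gamma 1 = val b ->
  (forall t, 0 <= t <= 1 -> ~ S (gamma t)) ->
  exists p : {path I from a to b}, forall t, val (p t) = gamma (ofI t).
Proof.
move=> cg g0 g1 gS.
pose q (t : I) : ~` S := exist _ (gamma (ofI t)) (mem_set (gS _ (ofI_itv t))).
have cq : continuous q.
  apply: continuous_comp_initial.
  exact: (cont_comp cg (@ofI_continuous R)).
have q0 : q zero = a by apply: val_inj; rewrite /= ofI0.
have q1 : q one = b by apply: val_inj; rewrite /= ofI1.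
by exists (mk_path cq q0 q1).
Qed.

Section covering.
Variables (X Y : riemannSurface R) (f : holomorphicMap X Y).
Variables (S : set Y) (z0 : ~` S).
Implicit Types (a b : fiber f z0) (s t : pi1 R z0).

Lemma fiberP a : f (val a) = val z0.
Proof. exact: (set_mem (valP a)). Qed.

Lemma monodromy1 a : monodromy 1%g a a.
Proof.
exists (const_path z0), (const_path (fiber_pt a)); split => // t.
exact: punctured_map_fiber.
Qed.

Lemma monodromyM s t a b c :
  monodromy s a b -> monodromy t b c -> monodromy (s * t)%g a c.
Proof.
move=> [g [h [<- gh]]] [g' [h' [<- gh']]].
exists (concat g g'), (concat h h'); split; first by rewrite pi1_mulgE.
by move=> u; rewrite !concatE; case: ifP.
Qed.

Lemma monodromyV s a b : monodromy s a b -> monodromy s^-1%g b a.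
Proof.
move=> [g [h [<- gh]]]; exists (path_rev g), (path_rev h).
by split; [rewrite -pi1_invE|move=> u; rewrite !path_revE].
Qed.

(** The image of the fundamental group upstairs is the stabilizer of the base
    point. Both sides ask for a loop of class s together with a closed lift. *)
Lemma GammaE a s : Gamma a s <-> monodromy s a a.
Proof.
split=> [[q _ <-]|[g [h [<- gh]]]].
  elim/pi1_ind: q => q; rewrite pi1_mapE.
  by exists (image_loop (@punctured_map_continuous _ _ _ f S)
    (punctured_map_fiber a) q), q.
exists (pi1_class h) => //; rewrite pi1_mapE; congr pi1_class.
by apply/path_eqP => t; rewrite -gh.
Qed.

Hypotheses (finS : finite_set S) (uS : unramified_outside f S).

Lemma monodromy_total s a : exists b, monodromy s a b.
Proof.
elim/pi1_ind: s => g.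
pose gamma (t : R) : Y := val (g (toI t)).
have cval : continuous (val : ~` S -> Y) by exact: initial_continuous.
have cg : continuous gamma.
  exact (cont_comp (cont_comp cval (@cts_fun _ _ g)) (@toI_continuous R)).
have gS (u : R) : ~ S (gamma u) by exact: (set_mem (valP (g (toI u)))).
have [|h [ch h0 hP]] := path_lifting uS (x0 := val a) cg gS.
  by rewrite /gamma toI0 // path_zero fiberP.
have h1 : (h 1 : X) \in fiber f z0.
  by apply/mem_set; rewrite /fiber /= hP ?ler01 ?lexx // /gamma toI1 // path_one.
pose b : fiber f z0 := exist _ (h 1) h1.
have hS (u : R) : 0 <= u <= 1 -> ~ (f @^-1` S) (h u).
  by move=> u01; rewrite /preimage /= hP.
have [p pP] :=
  path_in_complement (a := fiber_pt a) (b := fiber_pt b) ch h0 erefl hS.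
exists b, g, p; split => // u; apply: val_inj.
by rewrite /= pP hP ?ofI_itv // /gamma ofIK.
Qed.

Lemma preimage_isolated (p : X) :
  exists2 N : set X, nbhs p N & forall x, N x -> x <> p -> ~ (f @^-1` S) x.
Proof. exact: fibers_isolated. Qed.

(** Project a path joining a to b off the preimage of S, which exists because X
    is connected and this preimage is discrete. *)
Lemma monodromy_transitive a b : exists s, monodromy s a b.
Proof.
have aS := set_mem (fiber_subproof a); have bS := set_mem (fiber_subproof b).
have [g [cg g0 g1 gS]] := complement_path_connected preimage_isolated aS bS.
have [p pP] :=
  path_in_complement (a := fiber_pt a) (b := fiber_pt b) cg g0 g1 (fun u _ => gS u).
have cq : continuous (fun u => @punctured_map _ _ _ f S (p u)).
  exact: (cont_comp (@punctured_map_continuous _ _ _ f S) (@cts_fun _ _ p)).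
have q0 : @punctured_map _ _ _ f S (p zero) = z0.
  by rewrite path_zero punctured_map_fiber.
have q1 : @punctured_map _ _ _ f S (p one) = z0.
  by rewrite path_one punctured_map_fiber.
by exists (pi1_class (mk_path cq q0 q1)), (mk_path cq q0 q1), p.
Qed.

Lemma finite_set_isolated (q : Y) :
  exists2 N : set Y, nbhs q N & forall y, N y -> y <> q -> ~ S y.
Proof.
have clS : closed (S `\ q).
  have /accessible_finite_set_closed := hausdorff_accessible (@rs_hausdorff _ Y).
  by apply; exact: finite_setD.
exists (~` (S `\ q)).
  apply: open_nbhs_nbhs; split; first exact: closed_openC.
  by move=> [_]; exact.
by move=> y Ny yq Sy; apply: Ny.
Qed.

(** Lift a path that ends at the base point, starting from any point off the
    preimage of S. *)
Lemma fiber_nonempty : exists a : fiber f z0, True.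
Proof.
have [x _] := holo_nonconstant f.
have [p _ pS] := isolated_dense preimage_isolated (@filterT _ (nbhs x) _).
have [g [cg g0 g1 gS]] :=
  complement_path_connected finite_set_isolated pS (set_mem (valP z0)).
have [h [_ _ hP]] := path_lifting uS cg gS (esym g0).
have h1 : (h 1 : X) \in fiber f z0.
  by apply/mem_set; rewrite /fiber /= hP ?ler01 ?lexx.
by exists (exist _ (h 1) h1).
Qed.

End covering.

Section pairs.
Variables (X1 X2 Y : riemannSurface R).
Variables (f : holomorphicMap X1 Y) (g : holomorphicMap X2 Y).
Variables (S : set Y) (z0 : ~` S).

(** If there were infinitely many orbits, num_orbits would be 0, so one orbit
    really means one. *)
Lemma irreducible_pairP : irreducible_pair f g z0 <->
  exists orb, range (@diag_orbit R X1 X2 Y f g S z0) = [set orb].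
Proof.
rewrite /irreducible_pair /num_orbits; set D := range _; split; last first.
  by move=> [orb ->]; rewrite fset_set1 cardfs1.
have [finD|infD] := pselect (finite_set D).
  move=> /eqP/cardfs1P[orb DO]; exists orb; apply/seteqP; split=> o /=.
    by move=> Do; have : o \in fset_set D;
      [rewrite in_fset_set ?inE|rewrite DO inE => /eqP].
  by move=> ->; apply/set_mem; rewrite -in_fset_set // DO inE.
by rewrite /fset_set; case: pselect => //; rewrite cardfs0.
Qed.

End pairs.

(** If (a, b) and (a, b s) are in the same orbit, some t fixes a and maps b to b s,
    and s = (s t^-1) t is in the product of the stabilizers. Conversely, let t map
    a to a' and u map b to b'; writing t u^-1 = v w with v fixing a and w fixing
    b, the element v^-1 t = w u maps (a, b) to (a', b'). *)
Lemma irreducible_iff_stabilizer_product (X1 X2 Y : riemannSurface R)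
    (f : holomorphicMap X1 Y) (g : holomorphicMap X2 Y) (S : set Y) (z0 : ~` S) :
  finite_set S -> unramified_outside f S -> unramified_outside g S ->
  irreducible_pair f g z0 <->
  forall (a : fiber f z0) (b : fiber g z0),
    set_mulg (Gamma a) (Gamma b) = set_mulg (Gamma b) (Gamma a) /\
    set_mulg (Gamma b) (Gamma a) = [set: pi1 R z0].
Proof.
move=> finS uf ug; rewrite irreducible_pairP; split.
  move=> [orb oneO] a b.
  have orbitO ab : @diag_orbit R X1 X2 Y f g S z0 ab = orb.
    by have : [set orb] (diag_orbit ab) by rewrite -oneO; exists ab.
  have full s : set_mulg (Gamma b) (Gamma a) s.
    have [b' bb'] := monodromy_total ug s b.
    have : diag_orbit (a, b) (a, b').
      rewrite orbitO -(orbitO (a, b')); exists 1%g.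
      by split; exact: monodromy1.
    move=> [t [/= aa bb]].
    exists (s * t^-1)%g; first by apply/GammaE/(monodromyM bb')/monodromyV.
    by exists t; [exact/GammaE|rewrite mulgVK].
  have Gsub : set_mulg (Gamma b) (Gamma a) = setT by apply/seteqP; split.
  split => //; rewrite Gsub; apply/seteqP; split => // s _.
  have [u Gu [v Gv uv]] := full s^-1%g.
  exists v^-1%g; first by apply/GammaE/monodromyV/GammaE.
  exists u^-1%g; first by apply/GammaE/monodromyV/GammaE.
  by rewrite -invgM uv invgK.
move=> full.
have orbitT ab : @diag_orbit R X1 X2 Y f g S z0 ab = setT.
  apply/seteqP; split => // -[a' b'] _; case: ab => a b.
  have [t aa'] := monodromy_transitive finS a a'.
  have [u bb'] := monodromy_transitive finS b b'.
  have [eqG allG] := full a b.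
  have : set_mulg (Gamma a) (Gamma b) (t * u^-1)%g by rewrite eqG allG.
  move=> [v Gv [w Gw vw]].
  exists (v^-1 * t)%g; split => /=.
    by apply: monodromyM aa'; apply/monodromyV/GammaE.
  rewrite (_ : (v^-1 * t = w * u)%g); first by apply: monodromyM bb'; apply/GammaE.
  by rewrite -[t in LHS](mulgVK u) -vw -!mulgA mulKg.
have [a _] := fiber_nonempty z0 finS uf.
have [b _] := fiber_nonempty z0 finS ug.
exists setT; apply/seteqP; split => [_ [ab _ <-]|_ ->]; first exact: orbitT.
by exists (a, b).
Qed.

End monodromy_action.

Theorem theorem3p2 (R : realType) (C1 C2 : riemannSurface R)
    (f : holomorphicMap C1 (CP1 R)) (g : holomorphicMap C2 (CP1 R))
    (S : set (CP1 R)) (z0 : ~` S) :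
  finite_set S -> unramified_outside f S -> unramified_outside g S ->
  irreducible_pair f g z0 <->
  forall (a : fiber f z0) (b : fiber g z0),
    set_mulg (Gamma a) (Gamma b) = set_mulg (Gamma b) (Gamma a) /\
    set_mulg (Gamma b) (Gamma a) = [set: pi1 R z0].
Proof. exact: irreducible_iff_stabilizer_product. Qed.
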